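(* Let $\ell>0$ and $a,b\in\mathbb{R}$. For $r>0$ let $N_{a,b}(r)$ be the number of eigenvalues of $\mathcal{T}_{a,b}$ (counted with algebraic multiplicities) with real part smaller than $r$. Then $$N_{a,b}(r)=\frac{2\ell\sqrt r}{\pi}+O(1)\qquad\text{as } r\to+\infty.$$
   Context: On $L^2(0,\ell;\mathbb{C}^2)$ the operator $\mathcal{T}_{a,b}$ acts as $U\mapsto -U''$ (componentwise) on the domain $$\mathrm{Dom}(\mathcal{T}_{a,b})=\{U\in H^2(0,\ell;\mathbb{C}^2): U'(0)+iM_{a,b}U(0)=0,\ U'(\ell)=0\},\qquad M_{a,b}=\begin{pmatrix}a&b\\-b&0\end{pmatrix}.$$ Its spectrum consists of isolated eigenvalues of finite algebraic multiplicity. *)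

(* Defs.v *)
From HB Require Import structures.
From mathcomp Require Import all_boot all_order all_algebra.
From mathcomp Require Import complex.
From mathcomp Require Import all_classical all_reals all_analysis.
Set Implicit Arguments.
Unset Strict Implicit.
Unset Printing Implicit Defensive.
Import Order.TTheory GRing.Theory Num.Theory.
Import numFieldNormedType.Exports.
Local Open Scope classical_set_scope.
Local Open Scope complex_scope.
Local Open Scope ring_scope.

Section Defs.
Context {R : realType}.
Local Notation C := R[i].
Local Notation C2 := 'cV[R[i]]_2.
Local Notation mu := (@lebesgue_measure R).

(* Elements of L^2(0,l; C^2) are handled through representatives, i.e.
   functions on the whole line of which only the restriction to ]0, l[
   matters, up to equality almost everywhere. *)

Definition eqL2 (l : R) (U V : R -> C2) : Prop := ae_eq mu `]0, l[%classic U V.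

Definition L2 (l : R) (f : R -> C) : Prop :=
  [/\ measurable_fun `]0, l[%classic (fun x => complex.Re (f x)),
      measurable_fun `]0, l[%classic (fun x => complex.Im (f x)) &
      mu.-integrable `]0, l[%classic
        (fun x => (complex.Re (f x) ^+ 2 + complex.Im (f x) ^+ 2)%:E)].

Definition vecL2 (l : R) (U : R -> C2) : Prop :=
  forall j : 'I_2, L2 l (fun x => U x j 0).

Definition cintegral (D : set R) (f : R -> C) : C :=
  (\int[mu]_(x in D) complex.Re (f x)) +i* (\int[mu]_(x in D) complex.Im (f x)).

(* C^1_c(0,l) gives the same weak derivatives as C^oo_c(0,l); real-valued test
   functions suffice for complex-valued u, v by linearity. *)
Definition test_function (l : R) (phi : R -> R) : Prop :=
  [/\ forall x, derivable phi x 1,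
      continuous (derive1 phi) &
      exists c d : R, [/\ 0 < c, d < l &
        forall x, ~~ (c <= x <= d) -> phi x = 0]].

Definition weak_derivative (l : R) (u v : R -> C) : Prop :=
  forall phi : R -> R, test_function l phi ->
    cintegral `]0, l[%classic (fun x => (derive1 phi x)%:C * u x) =
    - cintegral `]0, l[%classic (fun x => (phi x)%:C * v x).

Definition vec_weak_derivative (l : R) (U V : R -> C2) : Prop :=
  forall j : 'I_2, weak_derivative l (fun x => U x j 0) (fun x => V x j 0).

(* U belongs to H^2(0,l; C^2), with U' = V and U'' = W. *)
Definition sobolev2 (l : R) (U V W : R -> C2) : Prop :=
  [/\ vecL2 l U, vecL2 l V, vecL2 l W,
      vec_weak_derivative l U V & vec_weak_derivative l V W].

Definition continuous_itv (l : R) (G : R -> C2) : Prop :=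
  forall j : 'I_2,
    {within `[0, l]%classic, continuous (fun x => complex.Re (G x j 0))} /\
    {within `[0, l]%classic, continuous (fun x => complex.Im (G x j 0))}.

(* z is the value at x (in [0, l]) of the continuous representative of U. *)
Definition trace_at (l : R) (U : R -> C2) (x : R) (z : C2) : Prop :=
  exists G : R -> C2, [/\ continuous_itv l G, eqL2 l U G & G x = z].

Definition Mab (a b : R) : 'M[C]_2 :=
  \matrix_(i < 2, j < 2) (nth 0 (nth [::] [:: [:: a; b]; [:: - b; 0]] i) j)%:C.

(* U is in Dom(T_{a,b}), with U' = V, and T_{a,b} U = - U'' = F. *)
Definition T_graph (l a b : R) (U F : R -> C2) : Prop :=
  exists V : R -> C2, sobolev2 l U V (fun x => - F x) /\
    exists u0 v0 : C2,
      [/\ trace_at l U 0 u0, trace_at l V 0 v0,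
          v0 + 'i%C *: (Mab a b *m u0) = 0 & trace_at l V l 0].

Definition T_eigenvalue (l a b : R) (lam : C) : Prop :=
  exists U : R -> C2,
    ~ eqL2 l U (fun=> 0) /\ T_graph l a b U (fun x => lam *: U x).

(* Kernel of (T_{a,b} - lam)^k with its natural domain. *)
Fixpoint ker_pow (l a b : R) (lam : C) (k : nat) (U : R -> C2) : Prop :=
  if k is k'.+1 then
    exists F : R -> C2, T_graph l a b U F /\
      ker_pow l a b lam k' (fun x => F x - lam *: U x)
  else vecL2 l U /\ eqL2 l U (fun=> 0).

Definition root_vector (l a b : R) (lam : C) (U : R -> C2) : Prop :=
  exists k : nat, ker_pow l a b lam k U.

Definition lin_indep (l : R) (n : nat) (U : 'I_n -> R -> C2) : Prop :=
  forall c : 'I_n -> C,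
    eqL2 l (fun x => \sum_(i < n) c i *: U i x) (fun=> 0) ->
    forall i, c i = 0.

(* Dimension, possibly +oo, of the space of root vectors modulo equality a.e. *)
Definition alg_mult (l a b : R) (lam : C) : \bar R :=
  ereal_sup [set n%:R%:E | n in [set n : nat |
    exists U : 'I_n -> R -> C2,
      (forall i, root_vector l a b lam (U i)) /\ lin_indep l U]].

Definition eig_count (l a b r : R) : \bar R :=
  \esum_(lam in [set lam : C | T_eigenvalue l a b lam /\ complex.Re lam < r])
    alg_mult l a b lam.

End Defs.

(* Main.v *)
Require Import Defs.
From HB Require Import structures.
From mathcomp Require Import all_boot all_order all_algebra.
From mathcomp Require Import complex.
From mathcomp Require Import all_classical all_reals all_analysis.
From mathcomp Require Import measurable_realfun ring lra.
Import Order.TTheory GRing.Theory Num.Theory.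
Import numFieldNormedType.Exports.
Local Open Scope classical_set_scope.
Local Open Scope ring_scope.

(** Write lam = k^2 and y = l - x. The solutions of -U'' = lam U with U'(l) = 0 are
    cos(k y) w, so the eigenvalues are the zeros of det(k sin(k l) + cos(k l) iM). The matrix
    iM has a left eigenvector, which makes the boundary condition triangular with diagonal
    entries mu1 and mu2; the generalized eigenspaces then reduce to the scalar problem
    u'(0) + mu u(0) = 0, whose Jordan chains have length at most 2, and length 1 for large
    lam. Hence the multiplicity of a large eigenvalue is the number of j for which
    k sin(k l) + mu_j cos(k l) = 0. Each of these two entire functions has finitely many
    zeros in a bounded set and, for large n, exactly one zero k near n pi / l, all large zeros
    being of this form up to sign. Each family contributes l sqrt(r) / pi + O(1). *)

(** The obstacle is that algebraic multiplicities must be controlled, not only the position of the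
    eigenvalues. From above, a combination of root vectors is made to vanish along the left
    eigenvector and afterwards in the remaining coordinate, which bounds the multiplicity by the sum
    of two scalar ones. From below, lam cannot be a zero for both mu1 and mu2 unless mu1 = mu2,
    because cos(k l) is nonzero there; the critical case is thus a double eigenvalue of iM, that is
    a^2 = 4 b^2, where iM may be defective and genuine Jordan chains have to be exhibited. Exact
    multiplicities are established only for large lam: the finitely many other eigenvalues have
    multiplicity at most 4 each and contribute O(1). Zeros are located by elementary means instead
    of contour integrals: existence by minimising the modulus over a square, uniqueness by the
    addition formulas, isolation by an expansion at the zero. *)

Set Implicit Arguments.
Unset Strict Implicit.
Unset Printing Implicit Defensive.

(** * Complex-valued functions of a real variable *)

Section ComplexCalculus.
Local Open Scope complex_scope.
Local Open Scope ring_scope.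
Context {R : realType}.
Local Notation C := R[i].
Local Notation Re := (@complex.Re R).
Local Notation Im := (@complex.Im R).
Implicit Types (z w : C) (x y t : R) (f g : R -> C).

Lemma scale_regE x y : x *: y = x * y. Proof. by []. Qed.

Lemma ceq z w : Re z = Re w -> Im z = Im w -> z = w.
Proof. by case: z => ? ?; case: w => ? ? /= -> ->. Qed.

Lemma cReD z w : Re (z + w) = Re z + Re w.
Proof. by case: z => ? ?; case: w. Qed.
Lemma cImD z w : Im (z + w) = Im z + Im w.
Proof. by case: z => ? ?; case: w. Qed.
Lemma cReN z : Re (- z) = - Re z. Proof. by case: z. Qed.
Lemma cImN z : Im (- z) = - Im z. Proof. by case: z. Qed.
Lemma cReM z w : Re (z * w) = Re z * Re w - Im z * Im w.
Proof. by case: z => ? ?; case: w. Qed.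
Lemma cImM z w : Im (z * w) = Re z * Im w + Im z * Re w.
Proof. by case: z => ? ?; case: w. Qed.
Lemma cReC x : Re x%:C = x. Proof. by []. Qed.
Lemma cImC x : Im x%:C = 0. Proof. by []. Qed.
Lemma cRe0 : Re 0 = 0. Proof. by []. Qed.
Lemma cIm0 : Im 0 = 0. Proof. by []. Qed.
Lemma cRe1 : Re 1 = 1. Proof. by []. Qed.
Lemma cIm1 : Im 1 = 0. Proof. by []. Qed.
Definition ReImE := (cReD, cImD, cReN, cImN, cReM, cImM, cReC, cImC, cRe0, cIm0, cRe1, cIm1).

(** Real and imaginary parts are kept apart so that the real derivation rules and the real mean
    value theorem apply to each. *)
Definition cder f (d : C) x :=
  is_derive x 1 (Re \o f) (Re d) /\ is_derive x 1 (Im \o f) (Im d).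

Lemma cder_eq f d e x : cder f d x -> d = e -> cder f e x.
Proof. by move=> + <-. Qed.

Lemma cder_uniq f d e x : cder f d x -> cder f e x -> d = e.
Proof.
by move=> [dr di] [er ei]; apply: ceq; [rewrite -(@derive_val _ _ _ _ _ _ _ dr)
  -(@derive_val _ _ _ _ _ _ _ er) | rewrite -(@derive_val _ _ _ _ _ _ _ di)
  -(@derive_val _ _ _ _ _ _ _ ei)].
Qed.

Lemma cder_cst z x : cder (fun=> z) 0 x.
Proof. by split; exact: is_derive_cst. Qed.

Lemma cderD f g d e x : cder f d x -> cder g e x ->
  cder (fun t => f t + g t) (d + e) x.
Proof.
move=> [dr di] [er ei]; split.
  rewrite (_ : Re \o _ = (Re \o f) + (Re \o g)).
    by rewrite cReD; exact: is_deriveD.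
  by apply/funext => t /=; rewrite cReD.
rewrite (_ : Im \o _ = (Im \o f) + (Im \o g)).
  by rewrite cImD; exact: is_deriveD.
by apply/funext => t /=; rewrite cImD.
Qed.

Lemma cderN f d x : cder f d x -> cder (fun t => - f t) (- d) x.
Proof.
move=> [dr di]; split.
  rewrite (_ : Re \o _ = - (Re \o f)).
    by rewrite cReN; exact: is_deriveN.
  by apply/funext => t /=; rewrite cReN.
rewrite (_ : Im \o _ = - (Im \o f)).
  by rewrite cImN; exact: is_deriveN.
by apply/funext => t /=; rewrite cImN.
Qed.

Lemma cderB f g d e x : cder f d x -> cder g e x ->
  cder (fun t => f t - g t) (d - e) x.
Proof. by move=> df dg; apply: cderD => //; exact: cderN. Qed.

Lemma cderM f g d e x : cder f d x -> cder g e x ->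
  cder (fun t => f t * g t) (d * g x + f x * e) x.
Proof.
move=> [dr di] [er ei]; split.
  rewrite (_ : Re \o _ = (Re \o f) * (Re \o g) - (Im \o f) * (Im \o g)).
    apply: (is_derive_eq (is_deriveB (is_deriveM dr er) (is_deriveM di ei))).
    by rewrite !ReImE !scale_regE /=; ring.
  by apply/funext => t /=; rewrite cReM.
rewrite (_ : Im \o _ = (Re \o f) * (Im \o g) + (Im \o f) * (Re \o g)).
  apply: (is_derive_eq (is_deriveD (is_deriveM dr ei) (is_deriveM di er))).
  by rewrite !ReImE !scale_regE /=; ring.
by apply/funext => t /=; rewrite cImM.
Qed.

Lemma cderZ z f d x : cder f d x -> cder (fun t => z * f t) (z * d) x.
Proof.
move=> df; apply: cder_eq; first by apply: cderM; [exact: cder_cst|exact: df].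
by rewrite mul0r add0r.
Qed.

Lemma cder_real (h : R -> R) a x : is_derive x 1 h a ->
  cder (fun t => (h t)%:C) a%:C x.
Proof. by move=> dh; split => //; exact: is_derive_cst. Qed.

Lemma cder_id x : cder (fun t => t%:C) 1 x.
Proof. by have -> : (1 : C) = 1%:C by []; exact: (@cder_real id). Qed.

Lemma cder_comp f d (h : R -> R) a x : cder f d (h x) -> is_derive x 1 h a ->
  cder (f \o h) (a%:C * d) x.
Proof.
move=> [dr di] dh; split; rewrite !ReImE.
  by apply: is_derive_eq; [exact: (@is_derive1_comp _ (Re \o f) h)|ring].
by apply: is_derive_eq; [exact: (@is_derive1_comp _ (Im \o f) h)|ring].
Qed.

Lemma cder_reflect f d (l : R) x : cder f d (l - x) ->
  cder (fun t => f (l - t)) (- d) x.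
Proof.
move=> df; apply: cder_eq.
  apply: (@cder_comp _ _ (fun t => l - t) (-1) _ df).
  rewrite (_ : (fun t => l - t) = cst l - id) //; apply: is_derive_eq.
  by rewrite sub0r.
by apply: ceq; rewrite !ReImE; ring.
Qed.

Definition ch y : R := (expR y + expR (- y)) / 2.
Definition sh y : R := (expR y - expR (- y)) / 2.

Lemma expRNy y : expR y * expR (- y) = 1.
Proof. by rewrite -expRD subrr expR0. Qed.

Lemma ch2sh2 y : ch y ^+ 2 = 1 + sh y ^+ 2.
Proof.
transitivity (expR y * expR (- y) + sh y ^+ 2); last by rewrite expRNy.
by rewrite /ch /sh; field.
Qed.

Lemma chN y : ch (- y) = ch y. Proof. rewrite /ch opprK. by rewrite addrC. Qed.
Lemma shN y : sh (- y) = - sh y. Proof. by rewrite /sh opprK; field. Qed.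
Lemma ch0 : ch 0 = 1. Proof. by rewrite /ch oppr0 expR0; field. Qed.
Lemma sh0 : sh 0 = 0. Proof. by rewrite /sh oppr0 expR0; field. Qed.

Lemma chD x y : ch (x + y) = ch x * ch y + sh x * sh y.
Proof. by rewrite /ch /sh opprD !expRD; field. Qed.
Lemma shD x y : sh (x + y) = sh x * ch y + ch x * sh y.
Proof. by rewrite /ch /sh opprD !expRD; field. Qed.

Global Instance is_derive_ch x : is_derive x 1 ch (sh x).
Proof.
rewrite (_ : ch = 2^-1 \*: (expR + (expR \o -%R))).
  by apply: is_derive_eq; rewrite ?scale_regE /sh; field.
by apply/funext => y; rewrite !fctE /ch /= ?scale_regE; field.
Qed.

Global Instance is_derive_sh x : is_derive x 1 sh (ch x).
Proof.
rewrite (_ : sh = 2^-1 \*: (expR - (expR \o -%R))).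
  by apply: is_derive_eq; rewrite ?scale_regE /ch; field.
by apply/funext => y; rewrite !fctE /sh /= ?scale_regE; field.
Qed.

(** The formula sin(x + iy) = sin x ch y + i cos x sh y, and its analogue for the cosine, serve as
    definitions: squared moduli then reduce to real functions. *)
Definition csin z : C := Complex (sin (Re z) * ch (Im z)) (cos (Re z) * sh (Im z)).
Definition ccos z : C := Complex (cos (Re z) * ch (Im z)) (- (sin (Re z) * sh (Im z))).

Lemma Re_csin z : Re (csin z) = sin (Re z) * ch (Im z). Proof. by []. Qed.
Lemma Im_csin z : Im (csin z) = cos (Re z) * sh (Im z). Proof. by []. Qed.
Lemma Re_ccos z : Re (ccos z) = cos (Re z) * ch (Im z). Proof. by []. Qed.
Lemma Im_ccos z : Im (ccos z) = - (sin (Re z) * sh (Im z)). Proof. by []. Qed.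
Definition ReImtE := (Re_csin, Im_csin, Re_ccos, Im_ccos, ReImE).

Lemma csinD z w : csin (z + w) = csin z * ccos w + ccos z * csin w.
Proof.
by apply: ceq; rewrite !ReImtE ?sinD ?cosD ?chD ?shD; ring.
Qed.

Lemma ccosD z w : ccos (z + w) = ccos z * ccos w - csin z * csin w.
Proof.
by apply: ceq; rewrite !ReImtE ?sinD ?cosD ?chD ?shD; ring.
Qed.

Lemma csinN z : csin (- z) = - csin z.
Proof. by apply: ceq; rewrite !ReImtE ?sinN ?cosN ?chN ?shN; ring. Qed.
Lemma ccosN z : ccos (- z) = ccos z.
Proof. by apply: ceq; rewrite !ReImtE ?sinN ?cosN ?chN ?shN; ring. Qed.
Lemma csin0 : csin 0 = 0.
Proof. by apply: ceq; rewrite !ReImtE ?sin0 ?sh0 ?mul0r ?mulr0. Qed.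
Lemma ccos0 : ccos 0 = 1.
Proof. by apply: ceq; rewrite !ReImtE ?sin0 ?cos0 ?sh0 ?ch0; ring. Qed.
Lemma ccos2csin2 z : ccos z ^+ 2 + csin z ^+ 2 = 1.
Proof. by rewrite -[RHS]ccos0 -(subrr z) ccosD ccosN csinN; ring. Qed.

(** Differentiation runs along a line of the complex plane: [z = 0], [w = sqrtc lam] gives the
    solutions of the differential equation, other choices the directional arguments about zeros. *)
Lemma cder_csin z w x :
  cder (fun t => csin (z + t%:C * w)) (w * ccos (z + x%:C * w)) x.
Proof.
split.
  rewrite (_ : Re \o _ = (sin \o (cst (Re z) + Re w \*: id)) *
                         (ch \o (cst (Im z) + Im w \*: id))).
    apply: is_derive_eq; rewrite !fctE /= !ReImtE /= ?scale_regE; rewrite ?(mul0r, subr0, addr0, add0r, mulr1) ![x * _]mulrC; ring.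
  apply/funext => t; rewrite !fctE /= !ReImtE /= ?scale_regE.
  by congr (sin _ * ch _); ring.
rewrite (_ : Im \o _ = (cos \o (cst (Re z) + Re w \*: id)) *
                       (sh \o (cst (Im z) + Im w \*: id))).
  apply: is_derive_eq; rewrite !fctE /= !ReImtE /= ?scale_regE; rewrite ?(mul0r, subr0, addr0, add0r, mulr1) ![x * _]mulrC; ring.
apply/funext => t; rewrite !fctE /= !ReImtE /= ?scale_regE.
by congr (cos _ * sh _); ring.
Qed.

Lemma cder_ccos z w x :
  cder (fun t => ccos (z + t%:C * w)) (- (w * csin (z + x%:C * w))) x.
Proof.
split.
  rewrite (_ : Re \o _ = (cos \o (cst (Re z) + Re w \*: id)) *
                         (ch \o (cst (Im z) + Im w \*: id))).
    apply: is_derive_eq; rewrite !fctE /= !ReImtE /= ?scale_regE; rewrite ?(mul0r, subr0, addr0, add0r, mulr1) ![x * _]mulrC; ring.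
  apply/funext => t; rewrite !fctE /= !ReImtE /= ?scale_regE.
  by congr (cos _ * ch _); ring.
rewrite (_ : Im \o _ = - ((sin \o (cst (Re z) + Re w \*: id)) *
                       (sh \o (cst (Im z) + Im w \*: id)))).
  apply: is_derive_eq; rewrite !fctE /= !ReImtE /= ?scale_regE; rewrite ?(mul0r, subr0, addr0, add0r, mulr1) ![x * _]mulrC; ring.
apply/funext => t; rewrite !fctE /= !ReImtE /= ?scale_regE.
by congr (- (sin _ * sh _)); ring.
Qed.

End ComplexCalculus.

(** * Continuous weak derivatives are classical *)

Section Regularity.
Local Open Scope complex_scope.
Local Open Scope ring_scope.
Context {R : realType}.
Local Notation mu := (@lebesgue_measure R).
Implicit Types (f g h P : R -> R) (a b c d x y l : R).

Lemma is_derive_continuous P f : (forall x, is_derive x 1 P (f x)) -> continuous P.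
Proof.
move=> Pf x; apply/differentiable_continuous/derivable1_diffP.
by have [] := Pf x.
Qed.

Lemma derive_increment P f a b : a < b -> (forall x, is_derive x 1 P (f x)) ->
  exists2 c, a < c < b & P b - P a = f c * (b - a).
Proof.
move=> ab Pf; have [|c cab ->] := @MVT R P f a b ab (fun x _ => Pf x).
  exact/continuous_subspaceT/(is_derive_continuous Pf).
by exists c => //; move: cab; rewrite in_itv.
Qed.

Lemma continuous_itv_integrable f a b : continuous f ->
  mu.-integrable `[a, b] (EFin \o f).
Proof.
move=> cf; apply: continuous_compact_integrable; first exact: segment_compact.
exact: continuous_subspaceT.
Qed.

Lemma continuous_primitive f : continuous f ->
  exists P, forall x, is_derive x 1 P (f x).
Proof.
move=> cf; pose G a x := (\int[mu]_(t in `[a, x]) f t)%R.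
have GB a b x : a <= b -> b <= x -> G a x - G a b = G b x.
  move=> ab bx; rewrite /G Rintegral_itvB ?bnd_simp//.
    rewrite Rintegral_itv_obnd_cbnd//.
    apply: integrableS (continuous_itv_integrable b x cf) => //.
    exact: subset_itv_oc_cc.
  exact: continuous_itv_integrable.
(* The oriented integral from 0 to [x]; starting both pieces at [Num.min x 0] covers both signs of
   [x] with one formula. *)
pose P x := G (Num.min x 0) x - G (Num.min x 0) 0.
have PE a x : a < Num.min x 0 -> P x = G a x - G a 0.
  move=> am; rewrite /P -(GB a _ x) ?(ltW am) ?ge_min ?lexx//.
  by rewrite -(GB a _ 0) ?(ltW am) ?ge_min ?lexx ?orbT//; ring.
exists P => x; pose a := Num.min x 0 - 1.
have ax : a < x by rewrite /a ltrBlDr (le_lt_trans (y := x)) ?ge_min ?lexx// ltrDl.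
have a0 : a < 0 by rewrite /a ltrBlDr (le_lt_trans (y := 0)) ?ge_min ?lexx ?orbT// add0r.
have xx1 : x < x + 1 by rewrite ltrDl.
have [dG G'] := continuous_FTC1_closed xx1
  (continuous_itv_integrable a (x + 1) cf) ax (cf x).
apply: (@near_eq_is_derive _ _ _ (G a - cst (G a 0))).
  near=> t; rewrite (PE a) // lt_min a0 andbT.
  by near: t; exact: lt_nbhsr.
have dG' : is_derive x 1 (G a) (f x).
  by apply: DeriveDef; [exact: dG|rewrite -derive1E; exact: G'].
by apply: is_derive_eq; rewrite subr0.
Unshelve. all: by end_near. Qed.

Lemma continuous_Rintegral P f a b : a < b -> continuous f ->
  (forall x, is_derive x 1 P (f x)) ->
  (\int[mu]_(x in `[a, b]) f x)%R = P b - P a.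
Proof.
move=> ab cf Pf; have cP := is_derive_continuous Pf.
rewrite /Rintegral (@continuous_FTC2 _ f P a b)//.
- exact: continuous_subspaceT.
- split; first by move=> x _; have [] := Pf x.
  + exact/cvg_at_right_filter/cP.
  + exact/cvg_at_left_filter/cP.
- by move=> x _; rewrite derive1E; have [] := Pf x.
Qed.

(** Projection onto [[0, l]]: composing with it extends a function continuous on the segment to one
    continuous on the line. *)
Definition clamp l x := Num.max 0 (Num.min l x).

Lemma clamp_in l x : 0 <= l -> 0 <= clamp l x <= l.
Proof. by move=> l0; rewrite /clamp le_max lexx ge_max l0 ge_min lexx. Qed.

Lemma clamp_id l x : 0 <= x <= l -> clamp l x = x.
Proof. by move=> /andP[x0 xl]; rewrite /clamp min_r// max_r. Qed.

Lemma continuous_clamp l : continuous (clamp l).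
Proof.
move=> x; apply: (@continuous_max _ _ (fun=> 0) (fun x => Num.min l x)).
  exact: cvg_cst.
by apply: (@continuous_min _ _ (fun=> l) id) => //; exact: cvg_cst.
Qed.

Lemma continuous_clamp_comp l g : 0 <= l -> {within `[0, l], continuous g} ->
  continuous (g \o clamp l).
Proof.
move=> l0 /subspace_continuousP cg x.
have cx : `[0, l]%classic (clamp l x) by rewrite /= in_itv; exact: clamp_in.
apply: (cvg_comp _ _ _ (cg _ cx)) => A /=.
rewrite /within /= => HA.
have HA' : \forall y \near x, `[0, l]%classic (clamp l y) -> A (clamp l y).
  exact: (@continuous_clamp l x _ HA).
apply: filterS HA' => y; apply.
by rewrite /= in_itv; exact: clamp_in.
Qed.

Lemma Rintegral_oo_cc f l : continuous f ->
  (\int[mu]_(y in `]0, l[) f y)%R = (\int[mu]_(y in `[0, l]) f y)%R.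
Proof.
move=> cf; have If := continuous_itv_integrable 0 l cf.
rewrite -Rintegral_itv_obnd_cbnd; last first.
  by apply: integrableS If => //; exact: subset_itv_oc_cc.
rewrite -Rintegral_itv_bndo_bndc//.
by apply: integrableS If => //; exact: subset_itv_oo_cc.
Qed.

(* The test function has derivative (D - m) eta, where D = g - int h, eta is a bump and m the
   eta-average of D; testing with it gives int (D - m)^2 eta = 0. *)
Lemma du_bois_reymond l g h : 0 < l ->
  {within `[0, l], continuous g} -> {within `[0, l], continuous h} ->
  (forall phi, test_function l phi ->
    (\int[mu]_(x in `]0, l[) (derive1 phi x * g x))%R =
    - (\int[mu]_(x in `]0, l[) (phi x * h x))%R) ->
  forall x, 0 < x < l -> is_derive x 1 g (h x).
Proof.
move=> l0 cg ch weak x /andP[x0 xl].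
pose gt := g \o clamp l; pose ht := h \o clamp l.
have cgt : continuous gt by exact: continuous_clamp_comp (ltW l0) cg.
have cht : continuous ht by exact: continuous_clamp_comp (ltW l0) ch.
have [H dH] := continuous_primitive cht.
have cH := is_derive_continuous dH.
pose c := x / 2; pose d := (x + l) / 2.
have c0 : 0 < c by rewrite /c; lra.
have cx : c < x by rewrite /c; lra.
have xd : x < d by rewrite /d; lra.
have dl : d < l by rewrite /d; lra.
have cd : c < d by lra.
pose eta y := Num.max 0 ((y - c) * (d - y)).
have ceta : continuous eta.
  move=> y; apply: (@continuous_max _ _ (fun=> 0) (fun y => (y - c) * (d - y))).
    exact: cvg_cst.
  by apply: cvgM; apply: cvgB => //; exact: cvg_cst.
have eta_ge0 y : 0 <= eta y by rewrite /eta le_max lexx.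
have eta_gt0 y : c < y < d -> 0 < eta y.
  by move=> /andP[cy yd]; rewrite /eta lt_max mulr_gt0 ?orbT// subr_gt0.
have eta0 y : ~~ (c <= y <= d) -> eta y = 0.
  rewrite /eta negb_and -!ltNge => /orP[yc|dy]; rewrite max_l//.
    by rewrite mulr_le0_ge0//; lra.
  by rewrite mulr_ge0_le0//; lra.
pose D y := gt y - H y.
have cD : continuous D by move=> y; apply: cvgB; [exact: cgt|exact: cH].
have [E dE] := continuous_primitive ceta.
have cDeta : continuous (fun y => D y * eta y).
  by move=> y; apply: cvgM; [exact: cD|exact: ceta].
have [DE dDE] := continuous_primitive cDeta.
have E_gt0 : 0 < E d - E c.
  have [xi /eta_gt0 xi0 ->] := derive_increment cd dE.
  by rewrite mulr_gt0// subr_gt0.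
(* This choice makes [phi] vanish at [d] as well as at [c], hence outside [[c, d]]. *)
pose m := (DE d - DE c) / (E d - E c).
pose psi y := (D y - m) * eta y.
pose phi y := (DE y - m * E y) - (DE c - m * E c).
have dphi y : is_derive y 1 phi (psi y).
  have -> : phi = (DE - m \*: E) - cst (DE c - m * E c) by [].
  by apply: is_derive_eq; rewrite scale_regE /psi; ring.
have cphi := is_derive_continuous dphi.
have cpsi : continuous psi.
  move=> y; apply: cvgM; last exact: ceta.
  by apply: cvgB; [exact: cD|exact: cvg_cst].
have phic : phi c = 0 by rewrite /phi subrr.
have phid : phi d = 0.
  by rewrite /phi /m; field; exact: lt0r_neq0.
have phi0 y : ~~ (c <= y <= d) -> phi y = 0.
  rewrite negb_and -!ltNge => /orP[yc|dy].
    have [xi /andP[_ xic]] := derive_increment yc dphi.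
    rewrite /psi eta0 ?mulr0 ?mul0r; last by rewrite negb_and -ltNge xic.
    by rewrite phic => /eqP; rewrite sub0r oppr_eq0 => /eqP.
  have [xi /andP[dxi _]] := derive_increment dy dphi.
  rewrite /psi eta0 ?mulr0 ?mul0r; last by rewrite negb_and -!ltNge dxi orbT.
  by rewrite phid subr0.
have phi_test : test_function l phi.
  split.
  - by move=> y; have [] := dphi y.
  - rewrite (_ : derive1 phi = psi)//; apply/funext => y.
    by rewrite derive1E; have [] := dphi y.
  - by exists c, d; split.
have cpg : continuous (fun y => psi y * gt y).
  by move=> y; apply: cvgM; [exact: cpsi|exact: cgt].
have cph : continuous (fun y => phi y * ht y).
  by move=> y; apply: cvgM; [exact: cphi|exact: cht].
have weak' : (\int[mu]_(y in `[0, l]) (psi y * gt y + phi y * ht y))%R = 0.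
  rewrite RintegralD//; try exact: continuous_itv_integrable.
  rewrite -!Rintegral_oo_cc//; apply/eqP; rewrite addr_eq0; apply/eqP.
  move: (weak _ phi_test) => {}weak.
  rewrite [LHS](_ : _ = (\int[mu]_(y in `]0, l[) (derive1 phi y * g y))%R).
    rewrite weak; congr (- _); apply: eq_Rintegral => y.
    rewrite inE /= in_itv /= => /andP[y0 yl].
    by rewrite /ht /= clamp_id// !ltW.
  apply: eq_Rintegral => y.
  rewrite inE /= in_itv /= => /andP[y0 yl].
  rewrite /gt /= clamp_id ?ltW//; congr (_ * _).
  by rewrite derive1E; have [] := dphi y.
have cT : continuous (fun y => psi y * gt y + phi y * ht y).
  by move=> y; apply: cvgD; [exact: cpg|exact: cph].
have [T dT] := continuous_primitive cT.
rewrite (continuous_Rintegral l0 cT dT) in weak'.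
(* A primitive of [(D - m)^2 eta]. It is nondecreasing, and [S 0 = S l] by the weak identity and
   [phi 0 = phi l = 0]; so it is constant and its derivative vanishes. *)
pose S y := T y - phi y * H y - m * phi y.
have dS y : is_derive y 1 S ((D y - m) ^+ 2 * eta y).
  have -> : S = T - phi * H - m \*: phi by [].
  apply: is_derive_eq; rewrite !scale_regE /psi /D; ring.
have S_le u v : u <= v -> S u <= S v.
  rewrite le_eqVlt => /predU1P[->//|uv]; rewrite -subr_ge0.
  have [xi _ ->] := derive_increment uv dS.
  by rewrite mulr_ge0 ?subr_ge0 ?(ltW uv)// mulr_ge0// sqr_ge0.
have SE y : 0 <= y <= l -> S y = S 0.
  move=> /andP[y0 yl]; apply/eqP; rewrite eq_le; apply/andP; split; last exact: S_le.
  have -> : S 0 = S l; last exact: S_le.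
  rewrite /S !phi0 ?mul0r ?mulr0 ?subr0; first last.
  - by rewrite negb_and -ltNge c0.
  - by rewrite negb_and -!ltNge dl orbT.
  by apply/eqP; rewrite eq_sym -subr_eq0 weak'.
have DE_m y : c < y < d -> D y = m.
  move=> /andP[cy yd].
  have S0 : is_derive y 1 S 0.
    apply: (@near_eq_is_derive _ _ _ (cst (S 0))).
    near=> t; rewrite /= SE//; apply/andP; split; apply: ltW; near: t.
      by apply: lt_nbhsr; lra.
    by apply: lt_nbhsl; lra.
  have : (D y - m) ^+ 2 * eta y = 0.
    by rewrite -(@derive_val _ _ _ _ _ _ _ (dS y)) (@derive_val _ _ _ _ _ _ _ S0).
  move/eqP; rewrite mulf_eq0 sqrf_eq0 subr_eq0 => /orP[/eqP //|/eqP e0].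
  by have := eta_gt0 y; rewrite cy yd e0 ltxx => /(_ isT).
rewrite (_ : h x = ht x); last by rewrite /ht /= clamp_id// !ltW.
apply: (@near_eq_is_derive _ _ _ (H + cst m)).
  near=> t.
  have tcd : c < t < d.
    by apply/andP; split; near: t; [exact: lt_nbhsr|exact: lt_nbhsl].
  rewrite !fctE /= -(DE_m _ tcd) /D /gt /= clamp_id; first by ring.
  by move: tcd => /andP[ct td]; apply/andP; split; lra.
by apply: is_derive_eq; rewrite addr0.
Unshelve. all: by end_near. Qed.

End Regularity.

(** * Weak derivatives with continuous representatives *)

Section WeakClassical.
Local Open Scope complex_scope.
Local Open Scope ring_scope.
Context {R : realType}.
Local Notation C := R[i].
Local Notation C2 := 'cV[R[i]]_2.
Local Notation Re := (@complex.Re R).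
Local Notation Im := (@complex.Im R).
Local Notation mu := (@lebesgue_measure R).
Implicit Types (l a b x : R) (lam : C).

Lemma aeS (P Q : R -> Prop) : (forall x, P x -> Q x) ->
  {ae mu, forall x, P x} -> {ae mu, forall x, Q x}.
Proof. by move=> PQ; apply: (@filterS _ _ (ae_filter_ringOfSetsType mu)). Qed.

Lemma aeS2 (P Q S : R -> Prop) : (forall x, P x -> Q x -> S x) ->
  {ae mu, forall x, P x} -> {ae mu, forall x, Q x} -> {ae mu, forall x, S x}.
Proof. by move=> PQ; apply: (@filterS2 _ _ (ae_filter_ringOfSetsType mu)). Qed.

(** Disagreement at one point spreads by continuity to an interval of positive length inside a null
    set. *)
Lemma ae_eq_continuous l (f g : R -> R) : 0 < l ->
  {within `[0, l], continuous f} -> {within `[0, l], continuous g} ->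
  {ae mu, forall x, `]0, l[%classic x -> f x = g x} ->
  forall x, 0 <= x <= l -> f x = g x.
Proof.
move=> l0 cf cg [N [mN N0 subN]] x xl; apply/eqP; rewrite -subr_eq0.
apply/negP => /negP fg.
pose h := (f \o clamp l) - (g \o clamp l).
have ch : continuous h.
  by move=> y; apply: cvgB; exact: continuous_clamp_comp (ltW l0) _ _.
have hx : h x != 0 by rewrite /h !fctE /= clamp_id.
have : \forall y \near x, h y != 0.
  have := ch x; move/(_ [set t | t != 0]) => /=; apply.
  by apply: open_nbhs_nbhs; split => //; exact: open_neq.
move=> /nbhs_ballP[e /= e0 be].
(* Cutting the ball down to []0, l[] leaves a nonempty interval even when [x] is an endpoint. *)
pose u := Num.max 0 (x - e); pose v := Num.min l (x + e).
have uv : u < v.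
  move/andP: xl => [x0 xl].
  by rewrite /u /v gt_max !lt_min; apply/andP; split; apply/andP; split; lra.
have : `]u, v[%classic `<=` N.
  move=> y; rewrite /= in_itv /= /u /v gt_max lt_min => /andP[/andP[y0 xy] /andP[yl yx]].
  apply: subN => /= yfg.
  have : h y != 0.
    by apply: be; rewrite /ball /= ltr_norml; apply/andP; split; lra.
  rewrite /h !fctE /= clamp_id ?(ltW y0) ?(ltW yl)//.
  by rewrite yfg ?subrr ?eqxx// in_itv /= y0.
move=> uvN; have : (mu `]u, v[%classic <= mu N)%E.
  by apply: le_measure => //; rewrite inE.
rewrite N0 lebesgue_measure_itv /= lte_fin uv.
by rewrite -EFinB lee_fin subr_le0 leNgt uv.
Qed.

Definition ccont l (f : R -> C) :=
  {within `[0, l], continuous (Re \o f)} /\ {within `[0, l], continuous (Im \o f)}.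

Lemma ae_eq_ccont l (f g : R -> C) : 0 < l -> ccont l f -> ccont l g ->
  {ae mu, forall x, `]0, l[%classic x -> f x = g x} ->
  forall x, 0 <= x <= l -> f x = g x.
Proof.
move=> l0 [cfr cfi] [cgr cgi] fg x xl; apply: ceq.
  apply: (ae_eq_continuous l0 cfr cgr) xl.
  by apply: aeS fg => y /[apply] /= ->.
apply: (ae_eq_continuous l0 cfi cgi) xl.
by apply: aeS fg => y /[apply] /= ->.
Qed.

Lemma within_measurable l (f : R -> R) : {within `[0, l], continuous f} ->
  measurable_fun `]0, l[ f.
Proof.
move=> cf; apply: (@measurable_funS _ _ _ _ `[0, l]) => //.
  exact: subset_itv_oo_cc.
exact: subspace_continuous_measurable_fun.
Qed.

Lemma test_function_continuous l (phi : R -> R) :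
  test_function l phi -> continuous phi.
Proof.
move=> [dphi _ _]; apply: (@is_derive_continuous _ _ (derive1 phi)) => x.
by apply: DeriveDef => //; rewrite derive1E.
Qed.

Lemma ae_Rintegral_mul l (phi f g : R -> R) : continuous phi ->
  measurable_fun `]0, l[ f -> {within `[0, l], continuous g} ->
  {ae mu, forall x, `]0, l[%classic x -> f x = g x} ->
  (\int[mu]_(x in `]0, l[) (phi x * f x) = \int[mu]_(x in `]0, l[) (phi x * g x))%R.
Proof.
move=> cphi mf cg fg.
have mphi : measurable_fun `]0, l[ phi.
  by apply: measurable_funTS; exact: continuous_measurable_fun.
rewrite /Rintegral; congr fine; apply: ae_eq_integral => //.
- by apply/measurable_EFinP; exact: measurable_funM.
- apply/measurable_EFinP; apply: measurable_funM => //; exact: within_measurable.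
- by apply: aeS fg => x /[apply] ->.
Qed.

(** Real test functions split the weak identity into real and imaginary parts. [L2] supplies the
    measurability needed to replace [u] and [v] by [g] and [h] under the integral. *)
Lemma weak_derivative_cder l (u v : R -> C) (g h : R -> C) : 0 < l ->
  L2 l u -> L2 l v -> weak_derivative l u v -> ccont l g -> ccont l h ->
  {ae mu, forall x, `]0, l[%classic x -> u x = g x} ->
  {ae mu, forall x, `]0, l[%classic x -> v x = h x} ->
  forall x, 0 < x < l -> cder g (h x) x.
Proof.
move=> l0 [mur mui _] [mvr mvi _] weak [cgr cgi] [chr chi] ug vh x xl; split.
  apply: (du_bois_reymond l0 cgr chr) xl => phi tphi.
  have cphi := test_function_continuous tphi; have [_ cdphi _] := tphi.
  rewrite -(ae_Rintegral_mul cdphi mur cgr); last first.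
    by apply: aeS ug => y /[apply] /= ->.
  rewrite -(ae_Rintegral_mul cphi mvr chr); last first.
    by apply: aeS vh => y /[apply] /= ->.
  have := weak _ tphi; rewrite /cintegral => /(congr1 Re); rewrite cReN /=.
  rewrite [LHS](_ : _ = (\int[mu]_(y in `]0, l[) (derive1 phi y * Re (u y)))%R).
    move=> ->; congr (- _); apply: eq_Rintegral => y _.
    by rewrite cReM cReC cImC mul0r subr0.
  by apply: eq_Rintegral => y _; rewrite cReM cReC cImC mul0r subr0.
apply: (du_bois_reymond l0 cgi chi) xl => phi tphi.
have cphi := test_function_continuous tphi; have [_ cdphi _] := tphi.
rewrite -(ae_Rintegral_mul cdphi mui cgi); last first.
  by apply: aeS ug => y /[apply] /= ->.
rewrite -(ae_Rintegral_mul cphi mvi chi); last first.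
  by apply: aeS vh => y /[apply] /= ->.
have := weak _ tphi; rewrite /cintegral => /(congr1 Im); rewrite cImN /=.
rewrite [LHS](_ : _ = (\int[mu]_(y in `]0, l[) (derive1 phi y * Im (u y)))%R).
  move=> ->; congr (- _); apply: eq_Rintegral => y _.
  by rewrite cImM cReC cImC mul0r addr0.
by apply: eq_Rintegral => y _; rewrite cImM cReC cImC mul0r addr0.
Qed.

End WeakClassical.

(** * Root vectors as chains of classical boundary value problems *)

Section ClassicalChains.
Local Open Scope complex_scope.
Local Open Scope ring_scope.
Context {R : realType}.
Local Notation C := R[i].
Local Notation C2 := 'cV[R[i]]_2.
Local Notation Re := (@complex.Re R).
Local Notation Im := (@complex.Im R).
Local Notation mu := (@lebesgue_measure R).
Implicit Types (l a b x : R) (lam z : C).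

Lemma ccontD l (f g : R -> C) : ccont l f -> ccont l g ->
  ccont l (fun x => f x + g x).
Proof.
move=> [fr fi] [gr gi]; split.
  rewrite (_ : _ \o _ = (Re \o f) + (Re \o g)).
    by move=> x; apply: cvgD; [exact: fr|exact: gr].
  by apply/funext => x /=; rewrite cReD.
rewrite (_ : _ \o _ = (Im \o f) + (Im \o g)).
  by move=> x; apply: cvgD; [exact: fi|exact: gi].
by apply/funext => x /=; rewrite cImD.
Qed.

Lemma ccontZ l z (f : R -> C) : ccont l f -> ccont l (fun x => z * f x).
Proof.
move=> [fr fi]; split.
  rewrite (_ : _ \o _ = (fun x => Re z * (Re \o f) x - Im z * (Im \o f) x)).
    move=> x; apply: cvgB; (apply: cvgM; first exact: cvg_cst).
      exact: fr.
    exact: fi.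
  by apply/funext => x /=; rewrite cReM.
rewrite (_ : _ \o _ = (fun x => Re z * (Im \o f) x + Im z * (Re \o f) x)).
  move=> x; apply: cvgD; (apply: cvgM; first exact: cvg_cst).
    exact: fi.
  exact: fr.
by apply/funext => x /=; rewrite cImM.
Qed.

Lemma ccont_cst l z : ccont l (fun=> z).
Proof. by split; move=> x; exact: cvg_cst. Qed.

(** Here [F] stands for [(T - lam) U], not for [T U] as in [T_graph], so that a chain of root
    vectors is an iteration of [bvp2]. *)
Definition bvp2 l a b lam (U F : R -> C2) : Prop :=
  exists V : R -> C2, [/\ continuous_itv l U, continuous_itv l V,
    forall x, 0 < x < l -> forall j : 'I_2,
      cder (fun t => U t j 0) (V x j 0) x /\
      cder (fun t => V t j 0) (- (lam * U x j 0 + F x j 0)) x,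
    V 0 + 'i%C *: (Mab a b *m U 0) = 0 & V l = 0].

Fixpoint chain2 l a b lam (k : nat) (U : R -> C2) : Prop :=
  if k is k'.+1 then exists F, bvp2 l a b lam U F /\ chain2 l a b lam k' F
  else U = fun=> 0.

Lemma chain2_continuous l a b lam k U : chain2 l a b lam k U ->
  continuous_itv l U.
Proof.
case: k => [->|k [F [[V [cU _ _ _ _]] _]]//] j.
rewrite (_ : (fun x => _) = fun=> Re 0); last by apply/funext => x; rewrite mxE.
rewrite (_ : (fun x => complex.Im _) = fun=> Im 0); last by apply/funext => x; rewrite mxE.
by split; move=> x; exact: cvg_cst.
Qed.

Lemma eqL2_coord l (U V : R -> C2) (j : 'I_2) : eqL2 l U V ->
  {ae mu, forall x, `]0, l[%classic x -> U x j 0 = V x j 0}.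
Proof. by apply: aeS => x /[apply] ->. Qed.

(** Regularity climbs the chain from its zero end: once the right-hand side has a continuous
    representative, so has U'' = - (lam U + Phi), and both weak derivatives become classical. *)
Lemma T_graph_bvp2 l a b lam (U F Phi : R -> C2) : 0 < l ->
  T_graph l a b U F -> continuous_itv l Phi ->
  eqL2 l (fun x => F x - lam *: U x) Phi ->
  exists G, eqL2 l U G /\ bvp2 l a b lam G Phi.
Proof.
move=> l0 [V [[LU LV LW wUV wVW] [u0 [v0 [[G [cG UG G0]] [H [cH VH H0]] bc
  [H' [cH' VH' H'l]]]]]]] cPhi FPhi.
exists G; split => //; exists H; split => //.
- move=> x xl j; split.
    exact: (weak_derivative_cder l0 (LU j) (LV j) (wUV j) (cG j) (cH j)
      (eqL2_coord j UG) (eqL2_coord j VH) xl).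
  apply: (weak_derivative_cder (h := fun x => - (lam * G x j 0 + Phi x j 0))
    l0 (LV j) (LW j) (wVW j) (cH j) _ (eqL2_coord j VH) _ xl).
    have := ccontZ (-1) (ccontD (ccontZ lam (cG j)) (cPhi j)).
    by under eq_fun do rewrite mulN1r.
  apply: aeS2 FPhi UG => y /[swap] UG FPhi yl.
  rewrite -(UG yl) -(FPhi yl) !mxE; ring.
- by rewrite H0 G0.
(* The trace of U' at [l] comes with its own representative [H'], which must be identified with [H]
   up to the endpoint. *)
- apply/matrixP => j k; rewrite ord1 -H'l.
  apply: (ae_eq_ccont l0 (cH j) (cH' j)); last by rewrite lexx ltW.
  by apply: aeS2 VH VH' => y VH VH' yl; rewrite -VH// VH'.
Qed.

Lemma ker_pow_chain2 l a b lam k U : 0 < l -> ker_pow l a b lam k U ->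
  exists G, eqL2 l U G /\ chain2 l a b lam k G.
Proof.
move=> l0; elim: k U => [|k IH] U /=.
  by move=> [_ U0]; exists (fun=> 0).
move=> [F [TUF /IH[Phi [FPhi cPhi]]]].
have [G [UG bG]] := T_graph_bvp2 l0 TUF (chain2_continuous cPhi) FPhi.
by exists G; split => //; exists Phi.
Qed.

Definition ccontinuous (T : topologicalType) (f : T -> C) :=
  continuous (Re \o f) /\ continuous (Im \o f).

Lemma cder_continuous (f g : R -> C) : (forall x, cder f (g x) x) -> ccontinuous f.
Proof.
move=> df; split.
  by apply: (@is_derive_continuous _ _ (Re \o g)) => x; have [] := df x.
by apply: (@is_derive_continuous _ _ (Im \o g)) => x; have [] := df x.
Qed.

Lemma ccontinuous_L2 l (f : R -> C) : ccontinuous f -> L2 l f.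
Proof.
move=> [fr fi]; split.
- by apply: measurable_funTS; exact: continuous_measurable_fun.
- by apply: measurable_funTS; exact: continuous_measurable_fun.
- have cf : continuous (fun x => Re (f x) ^+ 2 + Im (f x) ^+ 2).
    move=> x; apply: cvgD; apply: cvgM; [exact: fr|exact: fr|exact: fi|exact: fi].
  apply: integrableS (continuous_itv_integrable 0 l cf) => //.
  exact: subset_itv_oo_cc.
Qed.

Lemma weak_derivative_real l (p q phi : R -> R) : 0 < l -> continuous q ->
  (forall x, is_derive x 1 p (q x)) -> test_function l phi ->
  (\int[mu]_(x in `]0, l[) (derive1 phi x * p x))%R =
  - (\int[mu]_(x in `]0, l[) (phi x * q x))%R.
Proof.
move=> l0 cq dp tphi; have cphi := test_function_continuous tphi.
have cp := is_derive_continuous dp.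
have [dphi cdphi [c [d [c0 dl phi0]]]] := tphi.
have cf : continuous (fun x => derive1 phi x * p x).
  by move=> x; apply: cvgM; [exact: cdphi|exact: cp].
have cg : continuous (fun x => phi x * q x).
  by move=> x; apply: cvgM; [exact: cphi|exact: cq].
apply/eqP; rewrite -addr_eq0 !Rintegral_oo_cc// -RintegralD//; try exact: continuous_itv_integrable.
have dphip x : is_derive x 1 (phi * p) (derive1 phi x * p x + phi x * q x).
  have dphix : is_derive x 1 phi (derive1 phi x).
    by apply: DeriveDef => //; rewrite derive1E.
  by have dpx := dp x; apply: is_derive_eq; rewrite !scale_regE; ring.
rewrite (continuous_Rintegral l0 _ dphip).
  rewrite !fctE !phi0 ?mul0r ?subrr//; first by rewrite negb_and -ltNge c0.
  by rewrite negb_and -!ltNge dl orbT.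
by move=> x; apply: cvgD; [exact: cf|exact: cg].
Qed.

Lemma cder_weak_derivative l (f g : R -> C) : 0 < l -> ccontinuous g ->
  (forall x, cder f (g x) x) -> weak_derivative l f g.
Proof.
move=> l0 [gr gi] df phi tphi; apply: ceq; rewrite /cintegral ReImE /=.
  transitivity (\int[mu]_(x in `]0, l[) (derive1 phi x * Re (f x)))%R.
    by apply: eq_Rintegral => x _; rewrite !ReImE mul0r subr0.
  rewrite (weak_derivative_real l0 gr (fun x => proj1 (df x)) tphi).
  congr (- _); apply: eq_Rintegral => x _; by rewrite !ReImE mul0r subr0.
transitivity (\int[mu]_(x in `]0, l[) (derive1 phi x * Im (f x)))%R.
  by apply: eq_Rintegral => x _; rewrite !ReImE mul0r addr0.
rewrite (weak_derivative_real l0 gi (fun x => proj2 (df x)) tphi).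
congr (- _); apply: eq_Rintegral => x _; by rewrite !ReImE mul0r addr0.
Qed.

Lemma ccontinuous_itv l (U : R -> C2) :
  (forall j, ccontinuous (fun x => U x j 0)) -> continuous_itv l U.
Proof.
by move=> cU j; have [cr ci] := cU j; split; exact: continuous_subspaceT.
Qed.

(** The converse passage, for explicit root functions: being differentiable on the whole line they
    are their own continuous representatives. *)
Lemma cder_T_graph l a b (U V F : R -> C2) : 0 < l ->
  (forall x j, cder (fun t => U t j 0) (V x j 0) x) ->
  (forall x j, cder (fun t => V t j 0) (- F x j 0) x) ->
  (forall j, ccontinuous (fun t => - F t j 0)) ->
  V 0 + 'i%C *: (Mab a b *m U 0) = 0 -> V l = 0 ->
  T_graph l a b U F.
Proof.
move=> l0 dU dV cF bc0 bcl.
have cU j : ccontinuous (fun x => U x j 0) by exact: cder_continuous (fun x => dU x j).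
have cV j : ccontinuous (fun x => V x j 0) by exact: cder_continuous (fun x => dV x j).
have FE j : (fun x => (- F x) j 0) = (fun x => - F x j 0).
  by apply/funext => x; rewrite mxE.
have eqr (W : R -> C2) : eqL2 l W W by apply: aeW.
exists V; split.
  split=> [j|j|j|j|j]; try exact: ccontinuous_L2.
  - by rewrite FE; exact: ccontinuous_L2.
  - exact: cder_weak_derivative.
  - by rewrite FE; exact: cder_weak_derivative.
exists (U 0), (V 0); split => //.
- by exists U; split => //; exact: ccontinuous_itv.
- by exists V; split => //; exact: ccontinuous_itv.
- by exists V; split => //; exact: ccontinuous_itv.
Qed.

End ClassicalChains.

(** * Scalar root functions *)

Section ScalarChains.
Local Open Scope complex_scope.
Local Open Scope ring_scope.
Context {R : realType}.
Local Notation C := R[i].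
Local Notation Re := (@complex.Re R).
Local Notation Im := (@complex.Im R).
Implicit Types (l x y : R) (lam mu : C) (u v f g : R -> C).

Lemma ccontM l f g : ccont l f -> ccont l g -> ccont l (fun x => f x * g x).
Proof.
move=> [fr fi] [gr gi]; split.
  rewrite (_ : _ \o _ = (Re \o f) * (Re \o g) - (Im \o f) * (Im \o g)).
    by move=> x; apply: cvgB; apply: cvgM; [exact: fr|exact: gr|exact: fi|exact: gi].
  by apply/funext => x /=; rewrite cReM.
rewrite (_ : _ \o _ = (Re \o f) * (Im \o g) + (Im \o f) * (Re \o g)).
  by move=> x; apply: cvgD; apply: cvgM; [exact: fr|exact: gi|exact: fi|exact: gr].
by apply/funext => x /=; rewrite cImM.
Qed.

Lemma cder_ccont l f g : (forall x, cder f (g x) x) -> ccont l f.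
Proof. by move=> /cder_continuous[fr fi]; split; exact: continuous_subspaceT. Qed.

Lemma derive0_cst (l : R) (p : R -> R) : {within `[0, l], continuous p} ->
  (forall x, 0 < x < l -> is_derive x 1 p 0) -> forall x, 0 <= x <= l -> p x = p l.
Proof.
move=> cp dp x /andP[x0]; rewrite le_eqVlt => /predU1P[->//|xl].
have [||y _] := @MVT R p (fun=> 0) x l xl.
- move=> y; rewrite in_itv /= => /andP[xy yl]; apply: dp.
  by rewrite (le_lt_trans x0).
- apply: continuous_subspaceW cp; apply: subset_itvr.
  by rewrite bnd_simp.
- by rewrite mul0r => /eqP; rewrite subr_eq0 => /eqP.
Qed.

Lemma cder0_cst l f : ccont l f -> (forall x, 0 < x < l -> cder f 0 x) ->
  forall x, 0 <= x <= l -> f x = f l.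
Proof.
move=> [cr ci] df x xl; apply: ceq.
  by apply: (derive0_cst cr) => // y /df[].
by apply: (derive0_cst ci) => // y /df[].
Qed.

(** [cosl] and [sinl] solve z'' = - lam z with data (1, 0) and (0, 1) at 0. Dividing the sine by
    [sqrtc lam] makes it even in the root, and the value at [lam = 0] is the limit. *)
Definition cosl lam y : C := ccos (y%:C * sqrtc lam).
Definition sinl lam y : C :=
  if sqrtc lam == 0 then y%:C else csin (y%:C * sqrtc lam) / sqrtc lam.

Lemma cosl0 lam : cosl lam 0 = 1.
Proof. by rewrite /cosl mul0r ccos0. Qed.

Lemma sinl0 lam : sinl lam 0 = 0.
Proof. by rewrite /sinl; case: ifP => // _; rewrite mul0r csin0 mul0r. Qed.

Lemma sqrtc_sinl lam y : sqrtc lam * sinl lam y = csin (y%:C * sqrtc lam).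
Proof.
rewrite /sinl; case: eqP => [->|/eqP k0]; first by rewrite mul0r mulr0 csin0.
by rewrite mulrC mulfVK.
Qed.

Lemma cosl2sinl2 lam y : cosl lam y ^+ 2 + lam * sinl lam y ^+ 2 = 1.
Proof.
by rewrite -{2}[lam]sqr_sqrtc -exprMn sqrtc_sinl ccos2csin2.
Qed.

Lemma cder_cosl lam y : cder (cosl lam) (- (lam * sinl lam y)) y.
Proof.
have := cder_ccos 0 (sqrtc lam) y.
under eq_fun do rewrite add0r.
by rewrite add0r -sqrtc_sinl mulrA -expr2 sqr_sqrtc.
Qed.

Lemma cder_sinl lam y : cder (sinl lam) (cosl lam y) y.
Proof.
have [k0|k0] := eqVneq (sqrtc lam) 0.
  rewrite /cosl k0 mulr0 ccos0 (_ : sinl lam = fun t => t%:C); first exact: cder_id.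
  by apply/funext => t; rewrite /sinl k0 eqxx.
have := cderZ (sqrtc lam)^-1 (cder_csin 0 (sqrtc lam) y).
rewrite add0r mulrA mulVf// mul1r => H; move: H.
rewrite (_ : (fun t => _) = sinl lam)//.
by apply/funext => t; rewrite /sinl (negbTE k0) add0r mulrC.
Qed.

(* Both products below are first integrals of z'' = - lam z. *)
Lemma ode_unique l lam u v : 0 < l -> ccont l u -> ccont l v ->
  (forall x, 0 < x < l -> cder u (v x) x /\ cder v (- (lam * u x)) x) ->
  u l = 0 -> v l = 0 -> forall x, 0 <= x <= l -> u x = 0 /\ v x = 0.
Proof.
move=> l0 cu cv duv ul vl x xl.
pose c t := cosl lam (l - t); pose s t := sinl lam (l - t).
have dc t : cder c (lam * s t) t.
  by apply: cder_eq; [exact: cder_reflect (cder_cosl lam (l - t))|rewrite opprK].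
have ds t : cder s (- c t) t by exact: cder_reflect (cder_sinl lam (l - t)).
have cc := cder_ccont l dc; have cs := cder_ccont l ds.
have A : u x * c x + v x * s x = 0.
  rewrite (@cder0_cst l (fun x => u x * c x + v x * s x)) //.
  - by rewrite ul vl; ring.
  - by apply: ccontD; exact: ccontM.
  - move=> t /duv[du dv].
    apply: cder_eq; first by apply: cderD; apply: cderM; eauto.
    by ring.
have B : v x * c x - lam * (u x * s x) = 0.
  rewrite -mulNr (@cder0_cst l (fun x => v x * c x + (- lam) * (u x * s x))); last exact: xl.
  - by rewrite ul vl; ring.
  - by apply: ccontD; [exact: ccontM|apply: ccontZ; exact: ccontM].
  - move=> t /duv[du dv].
    apply: cder_eq; first by apply: cderD; [apply: cderM|apply: cderZ; apply: cderM]; eauto.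
    by ring.
(* Cramer's rule for the two linear relations [A] and [B], whose determinant is [cosl2sinl2]. *)
rewrite -[u x]mulr1 -[v x]mulr1 -(cosl2sinl2 lam (l - x)); split.
  transitivity (c x * (u x * c x + v x * s x) -
    s x * (v x * c x - lam * (u x * s x))); first by rewrite /c /s; ring.
  by rewrite A B; ring.
transitivity (lam * s x * (u x * c x + v x * s x) +
  c x * (v x * c x - lam * (u x * s x))); first by rewrite /c /s; ring.
by rewrite A B; ring.
Qed.

Definition bvp1 l mu lam u f : Prop :=
  exists v, [/\ ccont l u, ccont l v,
    forall x, 0 < x < l -> cder u (v x) x /\ cder v (- (lam * u x + f x)) x,
    v 0 + mu * u 0 = 0 & v l = 0].

Fixpoint chain1 l mu lam (k : nat) u : Prop :=
  if k is k'.+1 then exists f, bvp1 l mu lam u f /\ chain1 l mu lam k' f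
  else u = fun=> 0.

(* [croot j] is 1/j! times the j-th lam-derivative of cos(sqrt lam (l - x)), so that
   (- d^2/dx^2 - lam) croot (j + 1) = croot j; the formula for j = 2 needs lam <> 0. *)
Definition croot l lam (j : nat) x : C :=
  match j with
  | 0 => cosl lam (l - x)
  | 1 => - ((l - x)%:C * sinl lam (l - x)) / 2
  | _ => - ((l - x)%:C ^+ 2 * cosl lam (l - x) - (l - x)%:C * sinl lam (l - x)) / (8 * lam)
  end.

Definition droot l lam (j : nat) x : C :=
  match j with
  | 0 => lam * sinl lam (l - x)
  | 1 => (sinl lam (l - x) + (l - x)%:C * cosl lam (l - x)) / 2
  | _ => ((l - x)%:C * cosl lam (l - x) - sinl lam (l - x) -
          lam * (l - x)%:C ^+ 2 * sinl lam (l - x)) / (8 * lam)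
  end.

Lemma cder_cosl_refl l lam x :
  cder (fun t => cosl lam (l - t)) (lam * sinl lam (l - x)) x.
Proof.
by apply: cder_eq; [exact: cder_reflect (cder_cosl lam (l - x))|rewrite opprK].
Qed.

Lemma cder_sinl_refl l lam x :
  cder (fun t => sinl lam (l - t)) (- cosl lam (l - x)) x.
Proof. exact: cder_reflect (cder_sinl lam (l - x)). Qed.

Lemma cder_refl l x : cder (fun t => (l - t)%:C) (-1) x.
Proof. exact: (cder_reflect (f := fun t => t%:C) (cder_id (l - x))). Qed.

Let two0 : (2 : C) != 0. Proof. by rewrite pnatr_eq0. Qed.

Lemma cder_croot l lam j x : (j < 2)%N || (lam != 0) ->
  cder (croot l lam j) (droot l lam j x) x.
Proof.
have dc := cder_cosl_refl l lam x; have ds := cder_sinl_refl l lam x.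
have dy := cder_refl l x.
case: j => [_|[_|j /= lam0]]; rewrite /droot //.
  rewrite (_ : croot _ _ _ =
    fun t => (- 2^-1) * ((l - t)%:C * sinl lam (l - t))); last first.
    by apply/funext => t; rewrite /croot /droot; field.
  apply: cder_eq; [apply: cderZ; apply: cderM; eauto|by cbv beta; field].
rewrite (_ : croot _ _ _ = fun t => (- (8 * lam)^-1) *
  ((l - t)%:C * ((l - t)%:C * cosl lam (l - t)) - (l - t)%:C * sinl lam (l - t))).
  apply: cder_eq.
    by apply: cderZ; apply: cderB; apply: cderM; eauto; apply: cderM; eauto.
  by cbv beta; field.
by apply/funext => t; rewrite /croot /droot; field.
Qed.

Lemma cder_droot l lam j x : (j < 2)%N || (lam != 0) -> (j < 3)%N ->
  cder (droot l lam j)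
    (- (lam * croot l lam j x + (if j is j'.+1 then croot l lam j' x else 0))) x.
Proof.
have dc := cder_cosl_refl l lam x; have ds := cder_sinl_refl l lam x.
have dy := cder_refl l x.
case: j => [_ _|[_ _|[|//] /= lam0 _]]; rewrite /croot.
- by apply: cder_eq; [apply: cderZ; eauto|by cbv beta; ring].
- rewrite (_ : droot _ _ _ = fun t => 2^-1 *
    (sinl lam (l - t) + (l - t)%:C * cosl lam (l - t))); last first.
    by apply/funext => t; rewrite /croot /droot; field.
  apply: cder_eq; first by apply: cderZ; apply: cderD; eauto; apply: cderM; eauto.
  by cbv beta; field.
- rewrite (_ : droot _ _ _ = fun t => (8 * lam)^-1 *
    ((l - t)%:C * cosl lam (l - t) - sinl lam (l - t) -
     lam * ((l - t)%:C * ((l - t)%:C * sinl lam (l - t))))); last first.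
    by apply/funext => t; rewrite /croot /droot; field.
  apply: cder_eq.
    apply: cderZ; apply: cderB.
      by apply: cderB; eauto; apply: cderM; eauto.
    by apply: cderZ; apply: cderM; eauto; apply: cderM; eauto.
  by cbv beta; field.
Qed.

Lemma croot_end l lam j : croot l lam j l = (j == 0%N)%:R.
Proof.
by case: j => [|[|j]] /=; rewrite subrr ?cosl0 ?sinl0//; ring.
Qed.

Lemma droot_end l lam j : droot l lam j l = 0.
Proof.
by case: j => [|[|j]] /=; rewrite subrr ?cosl0 ?sinl0//; ring.
Qed.

(** The boundary form u'(0) + mu u(0) on [croot j]. At [j = 0] it is the characteristic function; at
    higher [j] it is 1/j! times the j-th lam-derivative of that function. *)
Definition bdry l mu lam j : C := droot l lam j 0 + mu * croot l lam j 0.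

(** If the cosine vanished, so would [lam * sinl lam l], against [cosl2sinl2]. *)
Lemma bdry0_cosl_neq0 l mu lam : bdry l mu lam 0 = 0 -> cosl lam l != 0.
Proof.
rewrite /bdry /= !subr0 => B; apply/eqP => c0; move: B (cosl2sinl2 lam l).
rewrite c0 mulr0 addr0 expr0n add0r => ls.
by rewrite expr2 mulrA ls mul0r => /eqP; rewrite eq_sym oner_eq0.
Qed.

(** The characteristic function has no triple zero: modulo the two vanishing conditions [bdry 2]
    collapses to [l cosl / (4 lam)]. At [lam = 0] the conditions would force [mu = 0] and then
    [l = 0]. *)
Lemma bdry2_neq0 l mu lam : 0 < l -> bdry l mu lam 0 = 0 -> bdry l mu lam 1 = 0 ->
  lam != 0 /\ bdry l mu lam 2 != 0.
Proof.
move=> l0 B0 B1; have c0 := bdry0_cosl_neq0 B0; move: B0 B1 c0.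
rewrite /bdry /= !subr0.
have := cosl2sinl2 lam l; set c := cosl lam l; set s := sinl lam l => cs B0 B1 c0.
have lC0 : l%:C != 0 by rewrite (inj_eq (@complexI R)) gt_eqF.
have lam0 : lam != 0.
  apply/eqP => lam0; move: B0 B1 cs {c0}; rewrite /s /c /sinl /cosl lam0 sqrtc0 eqxx mulr0 ccos0.
  rewrite !(mul0r, mulr1, add0r) => ->; rewrite mul0r addr0 => /eqP.
  by rewrite mulf_eq0 invr_eq0 (negbTE two0) orbF -mulr2n mulrn_eq0 (negbTE lC0).
split => //.
suff -> : (l%:C * c - s - lam * l%:C ^+ 2 * s) / (8 * lam) +
    mu * (- (l%:C ^+ 2 * c - l%:C * s) / (8 * lam)) = l%:C * c / (4 * lam).
  by rewrite !mulf_neq0// invr_eq0 mulf_neq0// pnatr_eq0.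
apply/eqP; rewrite -subr_eq0; apply/eqP.
have four0 : (4 : C) != 0 by rewrite pnatr_eq0.
transitivity (- (l%:C ^+ 2 * (lam * s + mu * c)) / (8 * lam) -
  2 * ((s + l%:C * c) / 2 + mu * (- (l%:C * s) / 2)) / (8 * lam)).
  by field; rewrite lam0.
by rewrite B0 B1; ring.
Qed.

(** Order of vanishing of the characteristic function at [lam], capped at 2 in accordance with
    [bdry2_neq0]. *)
Definition bmult l mu lam : nat :=
  if bdry l mu lam 0 != 0 then 0%N else if bdry l mu lam 1 != 0 then 1%N else 2%N.

(** Applying [- d^2/dx^2 - lam] lowers the index of [croot], so lengthening a chain shifts the
    coefficients up by one. The boundary condition at 0 then kills the coefficient of index [bmult],
    and the support never grows beyond it. *)
Lemma chain1_span l mu lam k u : 0 < l -> chain1 l mu lam k u ->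
  exists al : nat -> C, (forall j, (bmult l mu lam <= j)%N -> al j = 0) /\
    forall x, 0 <= x <= l -> u x = al 0%N * croot l lam 0 x + al 1%N * croot l lam 1 x.
Proof.
move=> l0; elim: k u => [|k IH] u.
  by move=> ->; exists (fun=> 0); split => // x _; rewrite !mul0r addr0.
move=> [f [[v [cu cv duv bc vl]] /IH[al [al0 fE]]]].
(* The coefficient of [croot 0] is the only free one; it is read off at [l], where the other [croot]
   vanish. *)
pose be j := if j is j'.+1 then al j' else u l.
(* [croot 2] is legitimate only for [lam != 0]; it can occur only when [bmult] is 2, which excludes
   [lam = 0]. *)
have cond (j : nat) : (2 <= j)%N -> be 2%N != 0 -> lam != 0.
  move=> _ be2; have : (1 < bmult l mu lam)%N.
    by rewrite ltnNge; apply: contra be2 => /al0 /= ->.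
  rewrite /bmult; case: ifPn => //; rewrite negbK => /eqP B0.
  case: ifPn => //; rewrite negbK => /eqP B1 _.
  by have [] := bdry2_neq0 l0 B0 B1.
have l0' : 0 <= l <= l by rewrite lexx ltW.
have l00 : (0 : R) <= 0 <= l by rewrite lexx ltW.
pose comb (r : R -> C -> nat -> R -> C) x :=
  be 0%N * r l lam 0%N x + (be 1%N * r l lam 1%N x + be 2%N * r l lam 2%N x).
have dcroot x : cder (comb croot) (comb droot x) x.
  apply: cderD; first by apply: cderZ; exact: cder_croot.
  apply: cderD; first by apply: cderZ; exact: cder_croot.
  have [->|/(cond 2%N isT) lam0] := eqVneq (be 2%N) 0.
    under eq_fun do rewrite mul0r; rewrite mul0r; exact: cder_cst.
  by apply: cderZ; apply: cder_croot; rewrite lam0.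
have ddroot x : cder (comb droot) (- (lam * comb croot x +
    (al 0%N * croot l lam 0 x + al 1%N * croot l lam 1 x))) x.
  apply: cder_eq.
    apply: cderD; first by apply: cderZ; exact: cder_droot.
    apply: cderD; first by apply: cderZ; exact: cder_droot.
    instantiate (1 := - (be 2%N * (lam * croot l lam 2 x + croot l lam 1 x))).
    have [->|/(cond 2%N isT) lam0] := eqVneq (be 2%N) 0.
      by under eq_fun do rewrite mul0r; rewrite mul0r oppr0; exact: cder_cst.
    by rewrite -mulrN; apply: cderZ; apply: cder_droot; rewrite ?lam0.
  by rewrite /comb /be; ring.
have cr := cder_ccont l dcroot; have cd := cder_ccont l ddroot.
have E : forall x, 0 <= x <= l -> u x - comb croot x = 0 /\ v x - comb droot x = 0.
  have cN g : ccont l g -> ccont l (fun x => - g x).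
    by move=> cg; under eq_fun do rewrite -mulN1r; exact: ccontZ.
  apply: (@ode_unique l lam _ (fun x => v x - comb droot x)) => //.
  - by apply: ccontD => //; exact: cN.
  - by apply: ccontD => //; exact: cN.
  - move=> x xl; have [du dv] := duv x xl; split; first exact: cderB.
    apply: cder_eq; first by apply: cderB; [exact: dv|exact: ddroot].
    have xl' : 0 <= x <= l by case/andP: xl => *; rewrite !ltW.
    by rewrite (fE x xl'); ring.
  - by rewrite /comb !croot_end /be /= !(mulr0, mulr1, addr0) subrr.
  - by rewrite /comb !droot_end vl !mulr0 !addr0 subrr.
have UE x : 0 <= x <= l -> u x = comb croot x.
  by move=> /E[/eqP + _]; rewrite subr_eq0 => /eqP.
have V0 : v 0 = comb droot 0.
  by have [_ /eqP] := E 0 l00; rewrite subr_eq0 => /eqP.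
have bc0 : be 0%N * bdry l mu lam 0 +
    (be 1%N * bdry l mu lam 1 + be 2%N * bdry l mu lam 2) = 0.
  by rewrite -bc V0 (UE _ l00) /comb /bdry; ring.
have beS j : (bmult l mu lam < j)%N -> be j = 0.
  by case: j => // j; rewrite ltnS => /al0.
(* In [bc0] the terms below [bmult] vanish through [bdry], those above through [beS]; a single term
   remains. *)
have bem : be (bmult l mu lam) = 0.
  move: beS bc0; rewrite /bmult; case: ifPn => [B0 beS|].
    rewrite (beS 1%N)// (beS 2%N)// !mul0r !addr0 => /eqP.
    by rewrite mulf_eq0 (negbTE B0) orbF => /eqP.
  rewrite negbK => /eqP B0; case: ifPn => [B1 beS|].
    rewrite B0 (beS 2%N)// mulr0 mul0r add0r addr0 => /eqP.
    by rewrite mulf_eq0 (negbTE B1) orbF => /eqP.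
  rewrite negbK => /eqP B1 _; have [_ B2] := bdry2_neq0 l0 B0 B1.
  rewrite B0 B1 !mulr0 !add0r => /eqP.
  by rewrite mulf_eq0 (negbTE B2) orbF => /eqP.
have be0 j : (bmult l mu lam <= j)%N -> be j = 0.
  by rewrite leq_eqVlt => /predU1P[<-//|/beS].
exists be; split => // x xl; rewrite UE// /comb (be0 2%N); first by ring.
by rewrite /bmult; case: ifP => // _; case: ifP.
Qed.

End ScalarChains.

(** * Reduction of the system to scalar problems *)

Section VectorChains.
Local Open Scope complex_scope.
Local Open Scope ring_scope.
Context {R : realType}.
Local Notation C := R[i].
Local Notation C2 := 'cV[R[i]]_2.
Local Notation mu := (@lebesgue_measure R).
Implicit Types (l a b x : R) (lam : C).

Lemma ord2P (i : 'I_2) : i = 0 \/ i = 1.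
Proof. by case: i => [[|[|//]]] Hi; [left|right]; exact: val_inj. Qed.

Lemma Mab_mulE a b (w : C2) :
  ('i%C *: (Mab a b *m w)) 0 0 = 'i%C * a%:C * w 0 0 + 'i%C * b%:C * w 1 0 /\
  ('i%C *: (Mab a b *m w)) 1 0 = - ('i%C * b%:C * w 0 0).
Proof.
have bN : (- b)%:C = - b%:C by apply: ceq; rewrite !ReImE ?oppr0.
rewrite !mxE !big_ord_recl !big_ord0 !mxE /= (_ : lift ord0 ord0 = 1); last exact: val_inj.
by rewrite bN; split; ring.
Qed.

Lemma bdry_coord a b (v u : C2) :
  v + 'i%C *: (Mab a b *m u) = 0 <->
  v 0 0 + ('i%C * a%:C * u 0 0 + 'i%C * b%:C * u 1 0) = 0 /\
  v 1 0 - 'i%C * b%:C * u 0 0 = 0.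
Proof.
have [m0 m1] := Mab_mulE a b u; rewrite -m0 -m1; split=> [/matrixP vu|[e0 e1]].
  by split; [have := vu 0 0|have := vu 1 0]; rewrite [X in X = _]mxE [X in _ = X]mxE.
apply/matrixP => i j; rewrite ord1 [X in X = _]mxE [X in _ = X]mxE.
by case: (ord2P i) => ->.
Qed.

(** [(p1, p2)] is a left eigenvector of iM for [mu2], and the first row of iM is
    [mu1 (1, 0) + kap (p1, p2)]. In the coordinates [(u_0, p1 u_0 + p2 u_1)], legitimate as
    [p2 != 0], iM is upper triangular. *)
Definition triangularized a b (mu1 mu2 p1 p2 kap : C) : Prop :=
  [/\ p2 != 0, 'i%C * a%:C * p1 - 'i%C * b%:C * p2 = mu2 * p1,
      'i%C * b%:C * p1 = mu2 * p2, 'i%C * a%:C = mu1 + kap * p1 &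
      'i%C * b%:C = kap * p2].

Lemma triangularizable a b : exists mu1 mu2 p1 p2 kap,
  [/\ triangularized a b mu1 mu2 p1 p2 kap, mu1 + mu2 = 'i%C * a%:C &
      mu1 * mu2 = - b%:C ^+ 2].
Proof.
have i2 : 'i%C * 'i%C = -1 :> C by rewrite -expr2 sqr_i.
pose ia : C := 'i%C * a%:C; pose ib : C := 'i%C * b%:C.
have ib2 : ib * ib = - b%:C ^+ 2 by rewrite /ib mulrACA i2; ring.
(* For [b = 0] the matrix is already diagonal, and the eigenvector [(mu2, ib)] used below would have
   [p2 = 0]. *)
have [b0|b0] := eqVneq b 0.
  have C0 : (0 : R)%:C = 0 by [].
  exists ia, 0, 0, 1, 0; rewrite b0 C0; split; [split|rewrite /ia; ring|ring].
  - exact: oner_neq0.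
  - by ring.
  - by ring.
  - by rewrite /ia; ring.
  - by ring.
pose sq := sqrtc (ia ^+ 2 + 4 * b%:C ^+ 2).
have sq2 : sq ^+ 2 = ia ^+ 2 + 4 * b%:C ^+ 2 by rewrite sqr_sqrtc.
pose mu1 := (ia - sq) / 2; pose mu2 := (ia + sq) / 2.
have two0 : (2 : C) != 0 by rewrite pnatr_eq0.
have sum12 : mu1 + mu2 = ia by rewrite /mu1 /mu2; field.
have prod12 : mu1 * mu2 = - b%:C ^+ 2.
  transitivity ((ia ^+ 2 - sq ^+ 2) / 4); first by rewrite /mu1 /mu2; field.
  by rewrite sq2; field.
exists mu1, mu2, mu2, ib, 1; split => //; split.
- rewrite mulf_neq0//; last by rewrite (inj_eq (@complexI R)).
  by apply/eqP => /(congr1 (@complex.Im R)) /eqP; rewrite oner_eq0.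
- rewrite -/ia -/ib ib2 -prod12 -sum12; ring.
- by rewrite -/ib mulrC.
- by rewrite -/ia -sum12; ring.
- by rewrite -/ib; ring.
Qed.

Section Chains.
Variables (l a b : R) (lam : C).
Hypothesis l0 : 0 < l.

Lemma bvp2_lin (z : C) U F U' F' : bvp2 l a b lam U F -> bvp2 l a b lam U' F' ->
  bvp2 l a b lam (fun x => z *: U x + U' x) (fun x => z *: F x + F' x).
Proof.
have linc (W W' : R -> C2) : continuous_itv l W -> continuous_itv l W' ->
    continuous_itv l (fun x => z *: W x + W' x).
  move=> cW cW' j; have := ccontD (ccontZ z (cW j)) (cW' j).
  by rewrite (_ : (fun x => _) = (fun x => (z *: W x + W' x) j 0))//;
    apply/funext => x; rewrite !mxE.
move=> [V [cU cV dUV bc Vl]] [V' [cU' cV' dUV' bc' Vl']].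
exists (fun x => z *: V x + V' x); split; try exact: linc.
- move=> x xl j; have [dU dV] := dUV x xl j; have [dU' dV'] := dUV' x xl j.
  split.
    under eq_fun do rewrite !mxE.
    by rewrite !mxE; apply: cderD => //; exact: cderZ.
  under eq_fun do rewrite !mxE.
  apply: cder_eq; first by apply: cderD; [apply: cderZ; exact: dV|exact: dV'].
  by rewrite !mxE; ring.
- transitivity (z *: (V 0 + 'i%C *: (Mab a b *m U 0)) +
    (V' 0 + 'i%C *: (Mab a b *m U' 0))).
    rewrite mulmxDr -scalemxAr !scalerDr !scalerA [z * _]mulrC addrACA; congr (_ + _).
  by rewrite bc bc' scaler0 addr0.
- by rewrite Vl Vl' scaler0 addr0.
Qed.

Lemma bvp2_0 : bvp2 l a b lam (fun=> 0) (fun=> 0).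
Proof.
have c0 : continuous_itv l (fun=> 0 : C2) by exact: (chain2_continuous (a := a)
  (b := b) (lam := lam) (k := 0%N)).
exists (fun=> 0); split => //.
- move=> x _ j; rewrite !mxE mulr0 addr0 oppr0.
  by split; exact: cder_cst.
- by rewrite mulmx0 scaler0 addr0.
Qed.

Lemma chain2_lin k (z : C) U U' : chain2 l a b lam k U -> chain2 l a b lam k U' ->
  chain2 l a b lam k (fun x => z *: U x + U' x).
Proof.
elim: k U U' => [|k IH] U U' /=.
  by move=> -> ->; apply/funext => x; rewrite scaler0 addr0.
move=> [F [bF cF]] [F' [bF' cF']]; exists (fun x => z *: F x + F' x).
by split; [exact: bvp2_lin|exact: IH].
Qed.

Lemma chain2_0 k : chain2 l a b lam k (fun=> 0).
Proof. by elim: k => //= k IH; exists (fun=> 0); split => //; exact: bvp2_0. Qed.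

Lemma chain2S k U : chain2 l a b lam k U -> chain2 l a b lam k.+1 U.
Proof.
elim: k U => [|k IH] U; first by move=> ->; exact: chain2_0.
by move=> [F [bF /IH cF]]; exists F.
Qed.

Lemma chain2_le k k' U : (k <= k')%N -> chain2 l a b lam k U -> chain2 l a b lam k' U.
Proof. by move=> /subnKC <-; elim: (k' - k)%N => [|d IH]; rewrite ?addn0// addnS => /IH/chain2S. Qed.

Lemma chain2_sum k n (U : 'I_n -> R -> C2) (c : 'I_n -> C) :
  (forall i, chain2 l a b lam k (U i)) ->
  chain2 l a b lam k (fun x => \sum_(i < n) c i *: U i x).
Proof.
elim: n U c => [|n IH] U c cU.
  by under eq_fun do rewrite big_ord0; exact: chain2_0.
under eq_fun do rewrite big_ord_recl.
by apply: chain2_lin => //; exact: IH.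
Qed.

Lemma cder_near_eq (f g : R -> C) d x : 0 < x < l ->
  (forall t, 0 < t < l -> f t = g t) -> cder f d x -> cder g d x.
Proof.
move=> /andP[x0 xl] fg.
have nfg : \forall t \near x, f t = g t.
  near=> t; apply: fg; apply/andP; split; near: t.
    exact: lt_nbhsr.
  exact: lt_nbhsl.
move=> [dr di]; split.
  by apply: near_eq_is_derive dr; apply: filterS nfg => t /= ->.
by apply: near_eq_is_derive di; apply: filterS nfg => t /= ->.
Unshelve. all: by end_near. Qed.

Variables (mu1 mu2 p1 p2 kap : C).
Hypothesis tri : triangularized a b mu1 mu2 p1 p2 kap.

Definition lcomb (U : R -> C2) x : C := p1 * U x 0 0 + p2 * U x 1 0.

Lemma lcomb_ccont U : continuous_itv l U -> ccont l (lcomb U).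
Proof. by move=> cU; apply: ccontD; apply: ccontZ; exact: cU. Qed.

(** Contracting the vector boundary condition with a left eigenvector decouples it into a scalar
    one. *)
Lemma chain2_lcomb k U : chain2 l a b lam k U -> chain1 l mu2 lam k (lcomb U).
Proof.
have [_ e1 e2 _ _] := tri.
elim: k U => [|k IH] U /=.
  by move=> ->; apply/funext => x; rewrite /lcomb !mxE !mulr0 addr0.
move=> [F [[V [cU cV dUV bc Vl]] /IH cF]]; exists (lcomb F); split => //.
exists (lcomb V); split; try exact: lcomb_ccont.
- move=> x xl; have [dU0 dV0] := dUV x xl 0; have [dU1 dV1] := dUV x xl 1.
  split; first by apply: cderD; exact: cderZ.
  apply: cder_eq; first by apply: cderD; apply: cderZ; eauto.
  by rewrite /lcomb; ring.
- have [b00 b10] := (bdry_coord a b (V 0) (U 0)).1 bc.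
  transitivity (p1 * 0 + p2 * 0 : C); last by ring.
  rewrite -{1}b00 -b10 /lcomb mulrDr !mulrA -e1 -e2; ring.
- by rewrite /lcomb Vl !mxE !mulr0 addr0.
Qed.

(** When [lcomb U] vanishes, the coupling term with [kap] drops out of the boundary condition.
    Differentiating twice shows that [lcomb F] vanishes too, so the hypothesis passes down the
    chain. *)
Lemma chain2_coord k U : chain2 l a b lam k U ->
  (forall x, 0 <= x <= l -> lcomb U x = 0) -> chain1 l mu1 lam k (fun x => U x 0 0).
Proof.
have [_ _ _ e3 e4] := tri.
elim: k U => [|k IH] U /=.
  by move=> -> _; apply/funext => x; rewrite mxE.
move=> [F [[V [cU cV dUV bc Vl]] cF]] pU.
have inW x : 0 < x < l -> 0 <= x <= l by case/andP => *; rewrite !ltW.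
have pV x : 0 < x < l -> lcomb V x = 0.
  move=> xl; have [dU0 _] := dUV x xl 0; have [dU1 _] := dUV x xl 1.
  have d1 : cder (lcomb U) (lcomb V x) x by apply: cderD; exact: cderZ.
  apply: (cder_uniq d1); apply: cder_near_eq (xl) _ (cder_cst 0 x) => t tl.
  by rewrite pU// inW.
have pF x : 0 < x < l -> lcomb F x = 0.
  move=> xl; have [_ dV0] := dUV x xl 0; have [_ dV1] := dUV x xl 1.
  have d1 : cder (lcomb V) (- (lam * lcomb U x + lcomb F x)) x.
    apply: cder_eq; first by apply: cderD; apply: cderZ; eauto.
    by rewrite /lcomb; ring.
  have := cder_uniq d1; move=> /(_ 0); rewrite pU ?inW// mulr0 add0r.
  move=> /(_ (cder_near_eq xl (fun t tl => esym (pV t tl)) (cder_cst 0 x))) /eqP.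
  by rewrite oppr_eq0 => /eqP.
have pF' x : 0 <= x <= l -> lcomb F x = 0.
  apply: (ae_eq_ccont l0 (lcomb_ccont (chain2_continuous cF)) (ccont_cst l 0)).
  by apply: aeW => t; rewrite /= in_itv; exact: pF.
exists (fun x => F x 0 0); split; last exact: IH.
exists (fun x => V x 0 0); split; [exact: cU|exact: cV| | |].
- by move=> x xl; have [dU0 dV0] := dUV x xl 0.
- have [b00 _] := (bdry_coord a b (V 0) (U 0)).1 bc; rewrite e3 e4 in b00.
  have := pU 0; rewrite lexx (ltW l0) => /(_ isT); rewrite /lcomb => p0.
  transitivity ((V 0 0 0 + ((mu1 + kap * p1) * U 0 0 0 + kap * p2 * U 0 1 0)) -
    kap * (p1 * U 0 0 0 + p2 * U 0 1 0)); first by ring.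
  by rewrite b00 p0 mulr0 subrr.
- by rewrite Vl mxE.
Qed.

End Chains.

End VectorChains.

(** * Algebraic multiplicities *)

Section Multiplicity.
Local Open Scope complex_scope.
Local Open Scope ring_scope.
Context {R : realType}.
Local Notation C := R[i].
Local Notation C2 := 'cV[R[i]]_2.
Local Notation mu := (@lebesgue_measure R).
Local Arguments croot : simpl never.
Variables (l a b : R) (lam mu1 mu2 p1 p2 kap : C).
Hypotheses (l0 : 0 < l) (tri : triangularized a b mu1 mu2 p1 p2 kap).

Lemma ae_eqL2_sum n (c : 'I_n -> C) (U G : 'I_n -> R -> C2) :
  (forall i, eqL2 l (U i) (G i)) ->
  eqL2 l (fun x => \sum_(i < n) c i *: U i x) (fun x => \sum_(i < n) c i *: G i x).
Proof.
move=> UG.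
have : {ae mu, forall x, forall i, `]0, l[%classic x -> U i x = G i x}.
  by apply: (@filter_forall _ _ _ _ (ae_filter_ringOfSetsType mu)) => i; exact: UG.
by apply: aeS => x UGx xl; apply: eq_bigr => i _; rewrite UGx.
Qed.

(** Dimension count: [lcomb] sends the combinations into an [m2]-dimensional space, and on its
    kernel, of dimension at least [n - m2 > m1], the first coordinate lies in an [m1]-dimensional
    one. Some nonzero combination therefore has both vanishing. *)
Lemma root_vectors_dependent n (U : 'I_n -> R -> C2) :
  (bmult l mu1 lam + bmult l mu2 lam < n)%N ->
  (forall i, root_vector l a b lam (U i)) -> ~ lin_indep l U.
Proof.
set m1 := bmult l mu1 lam; set m2 := bmult l mu2 lam => mn rU indep.
have /choice[kG kGP] : forall i, exists kG : nat * (R -> C2),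
    eqL2 l (U i) kG.2 /\ chain2 l a b lam kG.1 kG.2.
  by move=> i; have [k /(ker_pow_chain2 l0)[G UG]] := rU i; exists (k, G).
(* A common chain length [K] keeps linear combinations within chains. *)
pose G i := (kG i).2; pose K := (\max_(i < n) (kG i).1)%N.
have UG i : eqL2 l (U i) (G i) by have [] := kGP i.
have cG i : chain2 l a b lam K (G i).
  have [_] := kGP i; apply: chain2_le => //; exact: (leq_bigmax i).
have /choice[al alP] := fun i => chain1_span l0 (chain2_lcomb tri (cG i)).
pose A : 'M[C]_(n, m2) := \matrix_(i, j) al i j.
(* The rows of [B] are independent coefficient vectors of combinations killed by [lcomb]. *)
pose B := row_base (kermx A).
have BA : B *m A = 0 by apply/sub_kermxP; rewrite eq_row_base.
pose W t x := \sum_(i < n) B t i *: G i x.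
have cW t : chain2 l a b lam K (W t) by exact: chain2_sum.
have pW t x : 0 <= x <= l -> lcomb p1 p2 (W t) x = 0.
  move=> xl; have sum0 j : \sum_(i < n) B t i * al i j = 0.
    have [jm|jm] := ltnP j m2.
      transitivity ((B *m A) t (Ordinal jm)); last by rewrite BA mxE.
      by rewrite [RHS]mxE; apply: eq_bigr => i _; rewrite [A _ _]mxE.
    by rewrite big1// => i _; rewrite (alP i).1// mulr0.
  transitivity (\sum_(i < n) B t i * lcomb p1 p2 (G i) x).
    rewrite /lcomb /W !summxE !mulr_sumr -big_split /=; apply: eq_bigr => i _.
    by rewrite !mxE; ring.
  transitivity ((\sum_(i < n) B t i * al i 0%N) * croot l lam 0 x +
                (\sum_(i < n) B t i * al i 1%N) * croot l lam 1 x).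
    rewrite !mulr_suml -big_split /=; apply: eq_bigr => i _.
    by rewrite (alP i).2//; ring.
  by rewrite !sum0; ring.
have /choice[be beP] := fun t => chain1_span l0 (chain2_coord l0 tri (cW t) (pW t)).
pose D : 'M[C]_(_, m1) := \matrix_(t, j) be t j.
have [e eD e0] : exists2 e : 'rV_(\rank (kermx A)), e *m D = 0 & e != 0.
  have : ~~ row_free D.
    rewrite /row_free neq_ltn; apply/orP; left.
    rewrite (leq_ltn_trans (rank_leq_col D))// mxrank_ker ltn_subRL.
    by rewrite (leq_ltn_trans _ mn)// addnC leq_add2l rank_leq_col.
  rewrite -kermx_eq0 => /rowV0Pn[e /sub_kermxP eD e0]; by exists e.
pose d := e *m B.
have d0 : d != 0.
  apply: contra e0 => /eqP dz; have /row_freeP[B' BB'] := row_base_free (kermx A).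
  by rewrite -[e]mulmx1 -BB' mulmxA -/B -/d dz mul0mx.
have dW x : \sum_(i < n) d 0 i *: G i x = \sum_t e 0 t *: W t x.
  rewrite /W; under [RHS]eq_bigr do rewrite scaler_sumr.
  rewrite exchange_big /=; apply: eq_bigr => i _; rewrite mxE scaler_suml.
  by apply: eq_bigr => t _; rewrite scalerA.
have Z0 x : 0 <= x <= l -> (\sum_t e 0 t *: W t x) 0 0 = 0.
  move=> xl; have sum0 j : \sum_t e 0 t * be t j = 0.
    have [jm|jm] := ltnP j m1.
      transitivity ((e *m D) 0 (Ordinal jm)); last by rewrite eD mxE.
      by rewrite [RHS]mxE; apply: eq_bigr => t _; rewrite [D _ _]mxE.
    by rewrite big1// => t _; rewrite (beP t).1// mulr0.
  rewrite summxE.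
  transitivity ((\sum_t e 0 t * be t 0%N) * croot l lam 0 x +
                (\sum_t e 0 t * be t 1%N) * croot l lam 1 x).
    rewrite !mulr_suml -big_split /=; apply: eq_bigr => t _.
    by rewrite mxE (beP t).2//; ring.
  by rewrite !sum0; ring.
have Z1 x : 0 <= x <= l -> (\sum_t e 0 t *: W t x) 1 0 = 0.
  move=> xl; have p20 : p2 != 0 by case: tri.
  have : p1 * (\sum_t e 0 t *: W t x) 0 0 + p2 * (\sum_t e 0 t *: W t x) 1 0 = 0.
    rewrite !summxE !mulr_sumr -big_split /= big1// => t _.
    by rewrite !mxE -(mulr0 (e 0 t)) -(pW t x xl) /lcomb; ring.
  rewrite Z0// mulr0 add0r => /eqP.
  by rewrite mulf_eq0 (negbTE p20) => /eqP.
suff /indep dz : eqL2 l (fun x => \sum_(i < n) d 0 i *: U i x) (fun=> 0).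
  by case/eqP: d0; apply/rowP => i; rewrite [RHS]mxE; exact: dz.
apply: aeS (ae_eqL2_sum (fun i => d 0 i) UG) => x UGx xl.
rewrite UGx// dW; apply/matrixP => j k; rewrite ord1 mxE.
have xl' : 0 <= x <= l by move: xl; rewrite /= in_itv /= => /andP[? ?]; rewrite !ltW.
by case: (ord2P j) => ->; [exact: Z0|exact: Z1].
Qed.

Lemma alg_mult_le :
  (alg_mult l a b lam <= (bmult l mu1 lam + bmult l mu2 lam)%:R%:E)%E.
Proof.
apply: ge_ereal_sup => _ [n [U [rU iU]] <-].
rewrite lee_fin ler_nat leqNgt; apply/negP => /root_vectors_dependent.
by move=> /(_ U rU).
Qed.

Lemma alg_mult_ge0 : (0 <= alg_mult l a b lam)%E.
Proof.
apply: ereal_sup_ubound; exists 0%N => //=.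
by exists (fun _ _ => 0); split => [[]|c _ []].
Qed.

Lemma alg_mult_fin : alg_mult l a b lam \is a fin_num.
Proof. by rewrite ge0_fin_numE ?alg_mult_ge0// (le_lt_trans alg_mult_le) ?ltry. Qed.

(** [T - lam] sends [rootfun w w1] to [rootfun w1 0], which gives chains of length two. The value at
    [l] is [w], so independence can be tested on the vectors [w]. *)
Definition rootfun (w w1 : C2) x : C2 :=
  croot l lam 0 x *: w + croot l lam 1 x *: w1.

Lemma rootfun_coord (w w1 : C2) j :
  (fun x => rootfun w w1 x j 0) =
  fun x => w j 0 * croot l lam 0 x + w1 j 0 * croot l lam 1 x.
Proof. by apply/funext => x; rewrite /rootfun !mxE; ring. Qed.

(** With parameter 0, [bdry] is the bare derivative at 0, so the hypothesis is the vector boundary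
    condition. *)
Lemma rootfun_T_graph (w w1 : C2) :
  bdry l 0 lam 0 *: w + bdry l 0 lam 1 *: w1 +
    'i%C *: (Mab a b *m (croot l lam 0 0 *: w + croot l lam 1 0 *: w1)) = 0 ->
  T_graph l a b (rootfun w w1) (fun x => lam *: rootfun w w1 x + croot l lam 0 x *: w1).
Proof.
move=> bc.
pose V x : C2 := droot l lam 0 x *: w + droot l lam 1 x *: w1.
pose F x : C2 := lam *: rootfun w w1 x + croot l lam 0 x *: w1.
have VE j : (fun x => V x j 0) = fun x => w j 0 * droot l lam 0 x + w1 j 0 * droot l lam 1 x.
  by apply/funext => x; rewrite /V !mxE; ring.
have FE j : (fun x => - F x j 0) = fun x =>
   (- (lam * w j 0 + w1 j 0)) * croot l lam 0 x + (- (lam * w1 j 0)) * croot l lam 1 x.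
  by apply/funext => x; rewrite /F /rootfun !mxE; ring.
have d1 x j : cder (fun t => rootfun w w1 t j 0) (V x j 0) x.
  rewrite rootfun_coord (congr1 (fun f => f x) (VE j)).
  by apply: cderD; apply: cderZ; exact: cder_croot.
apply: (cder_T_graph l0 d1).
- move=> x j; rewrite VE (congr1 (fun f => f x) (FE j)).
  apply: cder_eq; first by apply: cderD; apply: cderZ; exact: cder_droot.
  by cbv beta iota; ring.
- move=> j; rewrite FE.
  apply: (@cder_continuous _ _ (fun x => (- (lam * w j 0 + w1 j 0)) * droot l lam 0 x +
    (- (lam * w1 j 0)) * droot l lam 1 x)) => x.
  by apply: cderD; apply: cderZ; exact: cder_croot.
- by rewrite -bc /V /bdry !mul0r !addr0.
- by rewrite /V !droot_end !scale0r addr0.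
Qed.

Lemma rootfun_end (w w1 : C2) : rootfun w w1 l = w.
Proof. by rewrite /rootfun !croot_end /= scale1r scale0r addr0. Qed.

Lemma rootfun_continuous (w w1 : C2) : continuous_itv l (rootfun w w1).
Proof.
move=> j; suff : ccont l (fun x => rootfun w w1 x j 0) by [].
rewrite rootfun_coord; apply: ccontD; apply: ccontZ;
  by apply: cder_ccont => x; exact: cder_croot.
Qed.

Lemma eqL2_rootfun0 (w w1 : C2) : eqL2 l (rootfun w w1) (fun=> 0) -> w = 0.
Proof.
move=> w0; rewrite -(rootfun_end w w1); apply/matrixP => j k; rewrite ord1 [RHS]mxE.
apply: (ae_eq_ccont l0 (rootfun_continuous w w1 j) (ccont_cst l 0)).
  by apply: aeS w0 => x /[apply] ->; rewrite mxE.
by rewrite lexx ltW.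
Qed.

Lemma ker_pow0_sub (U : R -> C2) : ker_pow l a b lam 0 (fun x => U x - U x).
Proof.
split; last by apply: aeW => x _; rewrite subrr.
move=> j; under eq_fun do rewrite subrr mxE.
by apply: ccontinuous_L2; split => x; exact: cvg_cst.
Qed.

Lemma eigenvalue_alg_mult_ge1 : T_eigenvalue l a b lam -> (1 <= alg_mult l a b lam)%E.
Proof.
move=> [U [U0 TU]]; apply: ereal_sup_ubound; exists 1%N => //=.
exists (fun=> U); split.
  move=> _; exists 1%N; exists (fun x => lam *: U x); split => //.
  exact: (ker_pow0_sub (fun x => lam *: U x)).
move=> c cU i; rewrite ord1; apply: contrapT => /eqP c0; apply: U0.
apply: aeS cU => x /[apply]; rewrite big_ord_recl big_ord0 addr0 => /eqP.
by rewrite scaler_eq0 (negbTE c0) => /eqP.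
Qed.

Lemma T_eigenvalue_bmult : T_eigenvalue l a b lam ->
  (0 < bmult l mu1 lam + bmult l mu2 lam)%N.
Proof.
move=> /eigenvalue_alg_mult_ge1 /le_trans /(_ alg_mult_le).
by rewrite lee_fin ler1n.
Qed.

Lemma bdry_mu (nu : C) j : bdry l nu lam j = bdry l 0 lam j + nu * croot l lam j 0.
Proof. by rewrite /bdry mul0r addr0. Qed.

(** The hypothesis is the characteristic equation of iM. For [b != 0] the eigenvector is
    [(nu, - ib)]; for [b = 0] the matrix is diagonal. *)
Lemma Mab_eigenvector (nu : C) : nu ^+ 2 = 'i%C * a%:C * nu + b%:C ^+ 2 ->
  exists2 w : C2, w != 0 & 'i%C *: (Mab a b *m w) = nu *: w.
Proof.
move=> nu2; pose mk (x y : C) : C2 := \col_(i < 2) (if i == 0 then x else y).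
have i2 : 'i%C * 'i%C = -1 :> C by rewrite -expr2 sqr_i.
have mk0 x y : mk x y 0 0 = x by rewrite mxE.
have mk1 x y : mk x y 1 0 = y by rewrite mxE.
have mkE x y : 'i%C * a%:C * x + 'i%C * b%:C * y = nu * x ->
    - ('i%C * b%:C * x) = nu * y ->
    'i%C *: (Mab a b *m mk x y) = nu *: mk x y.
  move=> e0 e1; have [m0 m1] := Mab_mulE a b (mk x y).
  apply/matrixP => i j; rewrite ord1 [RHS]mxE.
  by case: (ord2P i) => ->; rewrite ?m0 ?m1 !(mk0, mk1).
have mkn0 x y : (x != 0) || (y != 0) -> mk x y != 0.
  apply: contraTN => /eqP m; have := mk0 x y; have := mk1 x y.
  by rewrite m !mxE => <- <-; rewrite eqxx.
have [b0|b0] := eqVneq b 0.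
  have C0 : (0 : R)%:C = 0 by [].
  move: mkE nu2; rewrite b0 C0 => mkE nu2.
  have [nu0|nu0] := eqVneq nu 0.
    exists (mk 0 1); first by apply: mkn0; rewrite oner_neq0 orbT.
    by apply: mkE; rewrite nu0; ring.
  exists (mk 1 0); first by apply: mkn0; rewrite oner_neq0.
  apply: mkE; last by ring.
  by apply: (mulfI nu0); transitivity (nu ^+ 2); [rewrite nu2|]; ring.
exists (mk nu (- ('i%C * b%:C))).
  apply: mkn0; apply/orP; right; rewrite oppr_eq0 mulf_neq0//.
    by apply/eqP => /(congr1 (@complex.Im R)) /eqP; rewrite oner_eq0.
  by rewrite (inj_eq (@complexI R)).
apply: mkE; last by ring.
transitivity (nu ^+ 2); last by ring.
transitivity ('i%C * a%:C * nu - ('i%C * 'i%C) * b%:C ^+ 2); first by ring.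
by rewrite i2 nu2; ring.
Qed.

Lemma eigenvector_T_graph (nu : C) (w : C2) : bdry l nu lam 0 = 0 ->
  'i%C *: (Mab a b *m w) = nu *: w ->
  T_graph l a b (rootfun w 0) (fun x => lam *: rootfun w 0 x).
Proof.
move=> B0 Mw.
have := @rootfun_T_graph w 0; rewrite !scaler0 !addr0 -scalemxAr scalerA ['i%C * _]mulrC.
rewrite -scalerA Mw scalerA -scalerDl [_ * nu]mulrC -bdry_mu B0 scale0r => /(_ erefl).
by under [X in T_graph _ _ _ _ X]eq_fun do rewrite scaler0 addr0.
Qed.

Lemma bdry0_T_eigenvalue (nu : C) : nu ^+ 2 = 'i%C * a%:C * nu + b%:C ^+ 2 ->
  bdry l nu lam 0 = 0 -> T_eigenvalue l a b lam.
Proof.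
move=> /Mab_eigenvector[w w0 Mw] B0; exists (rootfun w 0); split.
  by move=> /eqL2_rootfun0/eqP; apply/negP.
exact: eigenvector_T_graph Mw.
Qed.

(* For a double eigenvalue nu of iM the matrix N = iM - nu is nilpotent, and a correction
   of w proportional to N w repairs the boundary condition of cos(sqrt lam (l - x)) w. *)
Lemma alg_mult_ge2 (nu : C) : 2 * nu = 'i%C * a%:C -> nu ^+ 2 = - b%:C ^+ 2 ->
  bdry l nu lam 0 = 0 -> bdry l nu lam 1 != 0 -> (2 <= alg_mult l a b lam)%E.
Proof.
move=> nu1 nu2 B0 B1.
pose iM (w : C2) : C2 := 'i%C *: (Mab a b *m w).
have iMD w w' : iM (w + w') = iM w + iM w' by rewrite /iM mulmxDr scalerDr.
have iMZ z w : iM (z *: w) = z *: iM w by rewrite /iM -scalemxAr !scalerA mulrC.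
pose N w := iM w - nu *: w.
have i2 : 'i%C * 'i%C = -1 :> C by rewrite -expr2 sqr_i.
have N2 w : N (N w) = 0.
  have [m0 m1] := Mab_mulE a b w; rewrite -/(iM w) in m0 m1.
  have [n0 n1] := Mab_mulE a b (N w); rewrite -/(iM (N w)) in n0 n1.
  have Nw0 : N w 0 0 = iM w 0 0 - nu * w 0 0 by rewrite /N !mxE.
  have Nw1 : N w 1 0 = iM w 1 0 - nu * w 1 0 by rewrite /N !mxE.
  have NNw j : N (N w) j 0 = iM (N w) j 0 - nu * N w j 0 by rewrite {1}/N !mxE.
  have ib2 : ('i%C * b%:C) * ('i%C * b%:C) = nu ^+ 2.
    by rewrite nu2 mulrACA i2; ring.
  move: nu1 m0 m1 n0 n1 ib2; set ia := 'i%C * a%:C; set ib := 'i%C * b%:C.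
  move=> nu1 m0 m1 n0 n1 ib2.
  apply/matrixP => i j; rewrite ord1 NNw [RHS]mxE.
  case: (ord2P i) => ->; rewrite ?n0 ?n1 Nw0 ?Nw1 m0 ?m1 -nu1.
    transitivity ((nu ^+ 2 - ib * ib) * w 0 0); first by ring.
    by rewrite ib2 subrr mul0r.
  transitivity ((nu ^+ 2 - ib * ib) * w 1 0); first by ring.
  by rewrite ib2 subrr mul0r.
pose c := croot l lam 0 0.
(* As [N] kills [w1 w], the boundary condition reads [bdry 0 *: w + bdry 1 *: w1 w + c *: N w = 0],
   with first coefficient zero. *)
pose w1 w := - (c / bdry l nu lam 1) *: N w.
have NZ z w : N (z *: w) = z *: N w.
  by rewrite /N iMZ scalerBr !scalerA [nu * _]mulrC.
have Nw1 w : N (w1 w) = 0 by rewrite /w1 NZ N2 scaler0.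
have root w : root_vector l a b lam (rootfun w (w1 w)).
  exists 2%N; exists (fun x => lam *: rootfun w (w1 w) x + croot l lam 0 x *: w1 w).
  have iME : forall v, iM v = N v + nu *: v by move=> v; rewrite /N subrK.
  have iMw1 : iM (w1 w) = nu *: w1 w by rewrite iME Nw1 add0r.
  split.
    apply: rootfun_T_graph.
    rewrite -/(iM _) iMD (iMZ (croot l lam 0 0)) (iMZ (croot l lam 1 0)) iMw1 iME.
    have gen (p q r s : C) (u v u1 : C2) :
      p *: u + q *: u1 + (r *: (v + nu *: u) + s *: (nu *: u1)) =
      (p + nu * r) *: u + (q + nu * s) *: u1 + r *: v.
      by apply/matrixP => i j; rewrite !mxE; ring.
    rewrite gen -!bdry_mu -/c.
    rewrite B0 scale0r add0r /w1 scalerA mulrN mulrCA mulfV// mulr1 scaleNr.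
    by rewrite addNr.
  rewrite (_ : (fun x => _) = rootfun (w1 w) 0); last first.
    by apply/funext => x; rewrite addrAC subrr add0r /rootfun scaler0 addr0.
  exists (fun x => lam *: rootfun (w1 w) 0 x); split; last exact: ker_pow0_sub.
  exact: eigenvector_T_graph iMw1.
apply: ereal_sup_ubound; exists 2%N => //=.
pose e (i : 'I_2) : C2 := delta_mx i 0.
exists (fun i => rootfun (e i) (w1 (e i))); split => [i|c' cU i]; first exact: root.
have : \sum_(i < 2) c' i *: e i = 0.
  apply: (@eqL2_rootfun0 _ (\sum_(i < 2) c' i *: w1 (e i))).
  apply: aeS cU => x /[apply] cU; transitivity (\sum_(i < 2) c' i *: rootfun (e i) (w1 (e i)) x).
    rewrite /rootfun !scaler_sumr -big_split /=.
    by apply: eq_bigr => k _; rewrite scalerDr !scalerA ![_ * c' k]mulrC.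
  exact: cU.
move=> /matrixP/(_ i 0); rewrite summxE mxE (bigD1 i)//= !mxE !eqxx mulr1 big1 ?addr0//.
by move=> k ki; rewrite !mxE eq_sym (negbTE ki) mulr0.
Qed.

End Multiplicity.

(** * Zeros of z sin z + m cos z *)

Section Zeros.
Local Open Scope complex_scope.
Local Open Scope ring_scope.
Context {R : realType}.
Local Notation C := R[i].
Local Notation Re := (@complex.Re R).
Local Notation Im := (@complex.Im R).
Implicit Types (x y d t : R) (z w m : C).

Definition nsq z : R := Re z ^+ 2 + Im z ^+ 2.

Lemma nsq_ge0 z : 0 <= nsq z. Proof. by rewrite addr_ge0// sqr_ge0. Qed.

Lemma nsq_eq0 z : (nsq z == 0) = (z == 0).
Proof.
rewrite paddr_eq0 ?sqr_ge0// !sqrf_eq0; apply/andP/eqP => [[/eqP r0 /eqP i0]|->//].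
exact: ceq.
Qed.

Lemma nsq_gt0 z : (0 < nsq z) = (z != 0).
Proof. by rewrite lt_def nsq_ge0 andbT nsq_eq0. Qed.

Lemma nsqM z w : nsq (z * w) = nsq z * nsq w.
Proof. by rewrite /nsq !ReImE; ring. Qed.

Lemma nsqN z : nsq (- z) = nsq z.
Proof. by rewrite /nsq !ReImE !sqrrN. Qed.

Lemma nsqD_le z w : nsq (z + w) <= 2 * nsq z + 2 * nsq w.
Proof.
rewrite /nsq !ReImE -subr_ge0.
rewrite [X in 0 <= X](_ : _ = (Re z - Re w) ^+ 2 + (Im z - Im w) ^+ 2); last by ring.
by rewrite addr_ge0// sqr_ge0.
Qed.

Lemma nsqD_ge z w : nsq z / 2 - nsq w <= nsq (z + w).
Proof.
have := nsqD_le (z + w) (- w); rewrite addrK nsqN; lra.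
Qed.

Lemma nsq_csin z : nsq (csin z) = sin (Re z) ^+ 2 + sh (Im z) ^+ 2.
Proof.
rewrite /nsq Re_csin Im_csin.
transitivity (sin (Re z) ^+ 2 * ch (Im z) ^+ 2 + cos (Re z) ^+ 2 * sh (Im z) ^+ 2).
  by ring.
by rewrite ch2sh2 cos2sin2; ring.
Qed.

Lemma nsq_ccos z : nsq (ccos z) = cos (Re z) ^+ 2 + sh (Im z) ^+ 2.
Proof.
rewrite /nsq Re_ccos Im_ccos.
transitivity (cos (Re z) ^+ 2 * ch (Im z) ^+ 2 + sin (Re z) ^+ 2 * sh (Im z) ^+ 2).
  by ring.
by rewrite ch2sh2 sin2cos2; ring.
Qed.

Lemma mvt0 (f df : R -> R) t : 0 < t -> (forall x, is_derive x 1 f (df x)) ->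
  exists2 c, 0 < c < t & f t - f 0 = df c * t.
Proof.
by move=> t0 fdf; have [c ct E] := derive_increment t0 fdf; exists c => //;
  rewrite E subr0.
Qed.

Lemma ch_ge1 y : 1 <= ch y.
Proof.
have ch0 : 0 <= ch y by rewrite divr_ge0// addr_ge0// expR_ge0.
by rewrite -(@ler_pXn2r _ 2)// ?nnegrE// expr1n ch2sh2 lerDl sqr_ge0.
Qed.

Lemma sh_ge y : 0 <= y -> y <= sh y.
Proof.
rewrite le_eqVlt => /predU1P[<-|y0]; first by rewrite sh0.
have [c _] := mvt0 y0 (@is_derive_sh R).
by rewrite sh0 subr0 => ->; rewrite ler_peMl ?ch_ge1// ltW.
Qed.

Lemma sqr_le_sh y : y ^+ 2 <= sh y ^+ 2.
Proof.
have pos t : 0 <= t -> t ^+ 2 <= sh t ^+ 2.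
  by move=> t0; rewrite ler_pXn2r ?nnegrE ?sh_ge// (le_trans t0) ?sh_ge.
have [y0|y0] := leP 0 y; first exact: pos.
by rewrite -(sqrrN y) -(sqrrN (sh y)) -shN pos// oppr_ge0 ltW.
Qed.

Lemma sh_le_mono x y : 0 <= x -> x <= y -> sh x <= sh y.
Proof.
move=> x0; rewrite le_eqVlt => /predU1P[->//|xy]; rewrite -subr_ge0.
have [c _ ->] := derive_increment xy (@is_derive_sh R).
by apply: mulr_ge0; [exact: le_trans ler01 (ch_ge1 _)|rewrite subr_ge0 ltW].
Qed.

Lemma sqr_sh_le x y : `|x| <= y -> sh x ^+ 2 <= sh y ^+ 2.
Proof.
move=> xy; have -> : sh x ^+ 2 = sh `|x| ^+ 2.
  by case: (ger0P x) => // _; rewrite shN sqrrN.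
rewrite ler_pXn2r ?nnegrE ?sh_le_mono//.
  by rewrite (le_trans (normr_ge0 x)) ?sh_ge.
by rewrite (le_trans (le_trans (normr_ge0 x) xy)) ?sh_ge// (le_trans (normr_ge0 x)).
Qed.

Lemma sqr_sin_le x : sin x ^+ 2 <= x ^+ 2.
Proof.
have pos t : 0 < t -> sin t ^+ 2 <= t ^+ 2.
  move=> t0; have [c _] := mvt0 t0 (@is_derive_sin R).
  by rewrite sin0 subr0 => ->; rewrite exprMn ler_piMl ?sqr_ge0//.
have [->|x0] := eqVneq x 0; first by rewrite sin0.
have [x1|x1] := ltP 0 x; first exact: pos.
by rewrite -(sqrrN x) -(sqrrN (sin x)) -sinN pos// oppr_gt0 lt_neqAle x0.
Qed.

Lemma cos_ge_half x : `|x| <= 1 -> 1 / 2 <= cos x.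
Proof.
move=> x1; have -> : cos x = 1 - 2 * sin (x / 2) ^+ 2.
  have {1}-> : x = (x / 2) *+ 2 by rewrite -mulr_natr mulfVK// pnatr_eq0.
  by rewrite cos_mulr2n cos2sin2; ring.
have := sqr_sin_le (x / 2).
have : x ^+ 2 <= 1 by rewrite -real_normK ?num_real// expr_le1.
rewrite exprMn; lra.
Qed.

Lemma sin_ge_half x : 0 <= x <= 1 -> x / 2 <= sin x.
Proof.
move=> /andP[]; rewrite le_eqVlt => /predU1P[<- _|x0 x1]; first by rewrite sin0 mul0r.
have [c /andP[c0 cx]] := mvt0 x0 (@is_derive_sin R).
rewrite sin0 subr0 => ->; rewrite mulrC ler_pM2r//.
have := @cos_ge_half c; rewrite mul1r; apply.
by rewrite ger0_norm ?(ltW c0) // (le_trans (ltW cx)).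
Qed.

Lemma sqr_sin_ge x : `|x| <= 1 -> x ^+ 2 / 4 <= sin x ^+ 2.
Proof.
have pos t : 0 <= t <= 1 -> t ^+ 2 / 4 <= sin t ^+ 2.
  move=> t01; have := sin_ge_half t01; case/andP: t01 => t0 _ ts.
  rewrite (_ : t ^+ 2 / 4 = (t / 2) ^+ 2); last by field.
  by rewrite ler_pXn2r ?nnegrE// ?(le_trans _ ts)// divr_ge0.
case: (ger0P x) => x0 x1; first by apply: pos; rewrite x0.
rewrite -(sqrrN x) -(sqrrN (sin x)) -sinN pos// x1 andbT; lra.
Qed.

(** On [[1, pi / 2]] the sine is at least 1/2, which excludes [|x| > 1]; below that
    [x^2 / 4 <= sin^2 x] gives the bound. *)
Lemma small_sin x : `|x| <= pi / 2 -> sin x ^+ 2 <= 1 / 64 -> `|x| <= 1 / 4.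
Proof.
move=> xpi s64.
have x1 : `|x| <= 1.
  rewrite leNgt; apply/negP => x1.
  have s1 : 1 / 2 <= sin `|x|.
    apply: (@le_trans _ _ (sin 1)).
      by have := @sin_ge_half 1; rewrite ler01 lexx; apply.
    have p1 := @pihalf_ge1 R; have p0 := @pi_gt0 R.
    rewrite ltW// ltr_sin// in_itv /=; apply/andP; split; lra.
  have : sin x ^+ 2 = sin `|x| ^+ 2.
    by case: (ger0P x) => // _; rewrite sinN sqrrN.
  by move=> E; rewrite E in s64; nra.
have := sqr_sin_ge x1; rewrite -[x ^+ 2]real_normK ?num_real//.
have := normr_ge0 x; nra.
Qed.

End Zeros.

(** * Position and uniqueness of the large zeros *)

Section CharacteristicZeros.
Local Open Scope complex_scope.
Local Open Scope ring_scope.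
Context {R : realType}.
Local Notation C := R[i].
Local Notation Re := (@complex.Re R).
Local Notation Im := (@complex.Im R).
Implicit Types (x y d t : R) (z w m : C).

(** The characteristic function after the rescaling [z = l k], [m = l mu], with [k^2 = lam]. *)
Definition gfun m z : C := z * csin z + m * ccos z.

Lemma gfunN m z : gfun m (- z) = gfun m z.
Proof. by rewrite /gfun csinN ccosN mulrNN. Qed.

Lemma sin_Dnpi x n : sin (x + n%:R * pi) ^+ 2 = sin x ^+ 2.
Proof.
elim: n => [|n IH]; first by rewrite mul0r addr0.
by rewrite -natr1 mulrDl mul1r addrA sinDpi sqrrN.
Qed.

Lemma cos_Dnpi x n : cos (x + n%:R * pi) ^+ 2 = cos x ^+ 2.
Proof. by rewrite !cos2sin2 sin_Dnpi. Qed.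

(** Moduli are compared in z sin z = - m cos z: the sine must be small against the cosine when [|z|]
    is large against [|m|]. *)
Lemma gfun0_small m z : gfun m z = 0 -> 64 * nsq m + 1 <= nsq z ->
  sin (Re z) ^+ 2 <= 1 / 64 /\ sh (Im z) ^+ 2 <= 1 / 63.
Proof.
move=> /eqP; rewrite addr_eq0 => /eqP /(congr1 nsq).
rewrite nsqN !nsqM nsq_csin nsq_ccos cos2sin2.
set S := sin _ ^+ 2; set H := sh _ ^+ 2.
have S0 : 0 <= S by exact: sqr_ge0.
have H0 : 0 <= H by exact: sqr_ge0.
have m0 := nsq_ge0 m; move=> E mz.
have le : (64 * nsq m + 1) * (S + H) <= nsq m * (1 - S + H).
  by rewrite -E ler_wpM2r// addr_ge0.
(* This says nothing for [m = 0]; there the summand 1 of the threshold gives [S + H <= 0]. *)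
have : nsq m * (65 * S + 63 * H - 1) <= 0 by nra.
have [m1|m1] := ltP 0 (nsq m).
  by rewrite pmulr_rle0// => h; split; lra.
have -> : nsq m = 0 by apply/eqP; rewrite eq_le m1.
by move=> _; have : S + H <= 0; [nra|split; lra].
Qed.

Lemma nearest_npi x : 0 <= x -> exists n : nat, `|x - n%:R * pi| <= pi / 2.
Proof.
move=> x0; have p0 := @pi_gt0 R.
have y0 : 0 <= x / pi + 1 / 2 by rewrite addr_ge0// divr_ge0// ltW.
exists (Num.truncn (x / pi + 1 / 2)).
have := truncn_itv y0; set n := Num.truncn _ => /andP[n1 n2].
have e : x = x / pi * pi by rewrite mulfVK// gt_eqF.
rewrite {1}e -mulrBl normrM (gtr0_norm p0) [pi / 2]mulrC ler_pM2r//.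
have {}n2 : x / pi + 1 / 2 < n%:R + 1 by rewrite natr1.
move: n1 n2; set q := x / pi => n1 n2.
rewrite ler_norml; apply/andP; split; lra.
Qed.

Definition near_npi (n : nat) z := `|Re z - n%:R * pi| <= 1 / 4 /\ `|Im z| <= 1 / 4.

Lemma gfun0_near m n z : gfun m z = 0 -> 64 * nsq m + 1 <= nsq z ->
  `|Re z - n%:R * pi| <= pi / 2 -> near_npi n z.
Proof.
move=> g0 mz xn; have [S H] := gfun0_small g0 mz; split.
  apply: small_sin => //; move: S; rewrite -{1}[Re z](subrK (n%:R * pi)).
  by rewrite sin_Dnpi.
have := sqr_le_sh (Im z); rewrite -[Im z ^+ 2]real_normK ?num_real//.
have := normr_ge0 (Im z); nra.
Qed.

Lemma gfun0_near_npi m z : gfun m z = 0 -> 64 * nsq m + 1 <= nsq z -> 0 <= Re z ->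
  exists n, near_npi n z.
Proof.
by move=> g0 mz /nearest_npi[n xn]; exists n; apply: (gfun0_near g0 mz).
Qed.

(** Combining both equations through the addition formula gives z w sin(z - w) = m cos z cos w (z -
    w). On the left [|sin(z - w)| >= |z - w| / 2] and [z w] is large, on the right the cosines are
    bounded; so [z = w]. *)
Lemma gfun0_unique m n z w : gfun m z = 0 -> gfun m w = 0 ->
  64 * nsq m + 1 <= nsq z -> 64 * nsq m + 1 <= nsq w ->
  near_npi n z -> near_npi n w -> z = w.
Proof.
move=> gz gw mz mw [xz yz] [xw yw].
have [_ Hz] := gfun0_small gz mz; have [_ Hw] := gfun0_small gw mw.
have key : z * w * csin (z - w) = m * (ccos z * ccos w) * (z - w).
  rewrite csinD csinN ccosN.
  transitivity (gfun m z * w * ccos w - gfun m w * z * ccos z +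
     m * (ccos z * ccos w) * (z - w)); first by rewrite /gfun; ring.
  by rewrite gz gw; ring.
apply/eqP; rewrite -subr_eq0 -nsq_eq0.
move: key => /(congr1 nsq); rewrite !nsqM.
have nc (u : C) : sh (Im u) ^+ 2 <= 1 / 63 -> nsq (ccos u) <= 2.
  by rewrite nsq_ccos => Ht; have := cos2Dsin2 (Re u); have := sqr_ge0 (sin (Re u)); lra.
have cz := nc _ Hz; have cw := nc _ Hw.
have snw : nsq (z - w) / 4 <= nsq (csin (z - w)).
  rewrite nsq_csin {1}/nsq.
  have d1 : `|Re (z - w)| <= 1.
    rewrite !ReImE (_ : Re z - Re w = (Re z - n%:R * pi) - (Re w - n%:R * pi)); last by ring.
    by apply: le_trans (ler_normB _ _) _; lra.
  have := sqr_sin_ge d1; have := sqr_le_sh (Im (z - w)); have := sqr_ge0 (Im (z - w)).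
  lra.
move=> E.
have m0 := nsq_ge0 m; have d0 := nsq_ge0 (z - w).
have c0 := nsq_ge0 (ccos z); have c0' := nsq_ge0 (ccos w).
rewrite eq_le d0 andbT leNgt; apply/negP => dpos.
have zw : 64 * nsq m + 1 <= nsq z * nsq w by nra.
have : (64 * nsq m + 1) * (nsq (z - w) / 4) <= nsq m * 4 * nsq (z - w).
  apply: (@le_trans _ _ (nsq z * nsq w * nsq (csin (z - w)))).
    by apply: ler_pM => //; [lra|rewrite divr_ge0].
  rewrite E; apply: ler_wpM2r => //; apply: ler_wpM2l => //.
  by rewrite (_ : 4 = 2 * 2); [apply: ler_pM|ring].
have : 0 <= nsq m * nsq (z - w) by exact: mulr_ge0.
nra.
Qed.

End CharacteristicZeros.

(** * Existence of a zero near each large multiple of pi *)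

Section ZeroExistence.
Local Open Scope complex_scope.
Local Open Scope ring_scope.
Context {R : realType}.
Local Notation C := R[i].
Local Notation Re := (@complex.Re R).
Local Notation Im := (@complex.Im R).
Implicit Types (x y d t : R) (z w m : C).

Lemma ccontinuousD (T : topologicalType) (f g : T -> C) :
  ccontinuous f -> ccontinuous g -> ccontinuous (fun p => f p + g p).
Proof.
move=> [fr fi] [gr gi]; split => p.
  rewrite (_ : _ \o _ = (Re \o f) \+ (Re \o g)).
    by apply: cvgD; [exact: fr|exact: gr].
  by apply/funext => q /=; rewrite cReD.
rewrite (_ : _ \o _ = (Im \o f) \+ (Im \o g)).
  by apply: cvgD; [exact: fi|exact: gi].
by apply/funext => q /=; rewrite cImD.
Qed.

Lemma ccontinuousM (T : topologicalType) (f g : T -> C) :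
  ccontinuous f -> ccontinuous g -> ccontinuous (fun p => f p * g p).
Proof.
move=> [fr fi] [gr gi]; split => p.
  rewrite (_ : _ \o _ = (fun q => (Re \o f) q * (Re \o g) q - (Im \o f) q * (Im \o g) q)).
    by apply: cvgB; apply: cvgM; [exact: fr|exact: gr|exact: fi|exact: gi].
  by apply/funext => q /=; rewrite cReM.
rewrite (_ : _ \o _ = (fun q => (Re \o f) q * (Im \o g) q + (Im \o f) q * (Re \o g) q)).
  by apply: cvgD; apply: cvgM; [exact: fr|exact: gi|exact: fi|exact: gr].
by apply/funext => q /=; rewrite cImM.
Qed.

Lemma ccontinuous_cst (T : topologicalType) z : ccontinuous (fun _ : T => z).
Proof. by split => p; exact: cvg_cst. Qed.

Definition toC (p : R * R) : C := Complex p.1 p.2.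

Lemma ch_continuous : continuous (@ch R).
Proof. exact: is_derive_continuous (@is_derive_ch R). Qed.
Lemma sh_continuous : continuous (@sh R).
Proof. exact: is_derive_continuous (@is_derive_sh R). Qed.

Lemma gfun_continuous m : ccontinuous (gfun m \o toC).
Proof.
have cs1 (f : R -> R) : continuous f -> continuous (fun p : R * R => f p.1).
  by move=> cf p; apply: (@continuous_comp _ _ _ fst f); [exact: cvg_fst|exact: cf].
have cs2 (f : R -> R) : continuous f -> continuous (fun p : R * R => f p.2).
  by move=> cf p; apply: (@continuous_comp _ _ _ snd f); [exact: cvg_snd|exact: cf].
have cM (f g : R * R -> R) : continuous f -> continuous g -> continuous (fun p => f p * g p).
  by move=> cf cg p; apply: cvgM; [exact: cf|exact: cg].
have cN (f : R * R -> R) : continuous f -> continuous (fun p => - f p).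
  by move=> cf p; apply: cvgN; exact: cf.
have cS := @continuous_sin R; have cC := @continuous_cos R.
apply: (@ccontinuousD _ (fun p => toC p * csin (toC p)) (fun p => m * ccos (toC p))).
  apply: ccontinuousM; first by split => p; [exact: cvg_fst|exact: cvg_snd].
  split.
    by apply: (cM (fun p => sin p.1) (fun p => ch p.2)); [exact: cs1|exact: cs2 ch_continuous].
  by apply: (cM (fun p => cos p.1) (fun p => sh p.2)); [exact: cs1|exact: cs2 sh_continuous].
apply: ccontinuousM; first exact: ccontinuous_cst.
split.
  by apply: (cM (fun p => cos p.1) (fun p => ch p.2)); [exact: cs1|exact: cs2 ch_continuous].
apply: (cN (fun p => sin p.1 * sh p.2)).
by apply: (cM (fun p => sin p.1) (fun p => sh p.2)); [exact: cs1|exact: cs2 sh_continuous].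
Qed.

Lemma nsq_gfun_continuous m : continuous (fun p => nsq (gfun m (toC p))).
Proof.
have [cr ci] := gfun_continuous m; move=> p.
apply: (@cvgD _ _ _ _ _ (fun p => Re (gfun m (toC p)) ^+ 2) (fun p => Im (gfun m (toC p)) ^+ 2)).
  by apply: cvgM; exact: cr.
by apply: cvgM; exact: ci.
Qed.

Definition dgfun m z : C := csin z + z * ccos z - m * csin z.

Lemma cder_gfun m z w t :
  cder (fun s => gfun m (z + s%:C * w)) (w * dgfun m (z + t%:C * w)) t.
Proof.
have dz : cder (fun s => z + s%:C * w) w t.
  apply: cder_eq; first by apply: cderD; [exact: cder_cst|apply: cderM; [exact: cder_id|exact: cder_cst]].
  by cbv beta; ring.
apply: cder_eq.
  by apply: cderD; [apply: cderM; [exact: dz|exact: cder_csin]|apply: cderZ; exact: cder_ccos].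
by rewrite /dgfun; cbv beta; ring.
Qed.

(** A minimum modulus principle along one line: in the direction [w] with [w g'(z) = - g(z)] the
    derivative of [|g|^2] is [- 2 |g(z)|^2], and at a minimum it is zero. *)
Lemma nsq_gfun_min m z (e : R) : 0 < e -> dgfun m z != 0 ->
  (forall w, `|Re w| < e -> `|Im w| < e -> nsq (gfun m z) <= nsq (gfun m (z + w))) ->
  gfun m z = 0.
Proof.
move=> e0 dg0 zmin.
have [w wE] : exists w, w * dgfun m z = - gfun m z.
  by exists (- (gfun m z / dgfun m z)); rewrite mulNr mulfVK.
pose G s := gfun m (z + s%:C * w).
have dG t : cder G (w * dgfun m (z + t%:C * w)) t by exact: cder_gfun.
pose phi : R -> R := (Re \o G) * (Re \o G) + (Im \o G) * (Im \o G).
have G0 : G 0 = gfun m z by rewrite /G mul0r addr0.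
have dphi t := is_deriveD (is_deriveM (dG t).1 (dG t).1) (is_deriveM (dG t).2 (dG t).2).
have dphi0 : is_derive (0 : R) 1 phi (- 2 * nsq (gfun m z)).
  apply: (is_derive_eq (dphi 0)).
  by rewrite !scale_regE /= G0 mul0r addr0 wE /nsq !ReImE; ring.
pose B := 1 + `|Re w| + `|Im w|.
have B0 : 0 < B by rewrite /B; have := normr_ge0 (Re w); have := normr_ge0 (Im w); lra.
pose r := e / B.
have r0 : 0 < r by rewrite divr_gt0.
have small t (v : R) : `|v| < B -> - r < t < r -> `|t * v| < e.
  move=> vB tr; rewrite normrM.
  have tr' : `|t| < r by rewrite ltr_norml.
  rewrite (_ : e = r * B); last by rewrite /r mulfVK// gt_eqF.
  exact: ltr_pM.
have phi'0 : is_derive (0 : R) 1 phi 0.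
  apply: (@derive1_at_min R phi (- r) r 0).
  - by rewrite ltW// (lt_trans (y := 0)) ?oppr_lt0.
  - by move=> t _; have [] := dphi t.
  - by rewrite in_itv /= oppr_lt0 r0.
  - move=> t; rewrite in_itv /= => tr.
    have phiE s : phi s = nsq (G s) by [].
    rewrite !phiE G0; apply: zmin; rewrite !ReImE mul0r ?subr0 ?addr0; apply: small => //.
      by rewrite /B; have := normr_ge0 (Im w); lra.
    by rewrite /B; have := normr_ge0 (Re w); lra.
have := @derive_val _ _ _ _ _ _ _ dphi0; rewrite (@derive_val _ _ _ _ _ _ _ phi'0).
move=> /eqP; rewrite eq_sym mulf_eq0 oppr_eq0 pnatr_eq0 /= nsq_eq0.
by move/eqP.
Qed.

(** [|gfun|^2] is minimised over the square of half-side 1 around n pi. The centre has value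
    [|m|^2], the boundary a larger one, so the minimum is interior; the derivative is nonzero there.
    The factor 8 is 4, from the lower bounds 1/4, times the 2 of [nsqD_ge]. *)
Lemma gfun_zero_exists m (n : nat) :
  1 + 8 * (nsq m * (2 + sh 1 ^+ 2) + nsq (1 - m) * (1 + sh 1 ^+ 2))
    < (n%:R * pi - 1) ^+ 2 -> 1 <= n%:R * pi :> R ->
  exists z, [/\ gfun m z = 0, `|Re z - n%:R * pi| < 1 & `|Im z| < 1].
Proof.
set K := sh 1 ^+ 2; set X := n%:R * pi => bnd X1.
have K0 : 0 <= K by exact: sqr_ge0.
have m0 := nsq_ge0 m; have m1 := nsq_ge0 (1 - m).
pose A := (`[X - 1, X + 1]%classic `*` `[- 1, 1]%classic) : set (R * R).
pose phi p := nsq (gfun m (toC p)).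
have cphi : continuous phi := @nsq_gfun_continuous m.
have A0 : A !=set0.
  by exists (X, 0); split => /=; rewrite in_itv /=; apply/andP; split; lra.
have cA : compact A by apply: compact_setX; exact: segment_compact.
have [[x y] /set_mem[/= xA yA] pmin] := compact_EVT_min A0 cA (continuous_subspaceT cphi).
move: xA yA; rewrite !in_itv /= => /andP[x1 x2] /andP[y1 y2].
have dx : `|x - X| <= 1 by rewrite ler_norml; apply/andP; split; lra.
have dy : `|y| <= 1 by rewrite ler_norml; apply/andP; split; lra.
pose z : C := Complex x y.
have nz : (X - 1) ^+ 2 <= nsq z.
  rewrite /nsq /=; have := sqr_ge0 y.
  have : (X - 1) ^+ 2 <= x ^+ 2 by rewrite ler_pXn2r ?nnegrE//; lra.
  lra.
have H1 : sh y ^+ 2 <= K by exact: sqr_sh_le.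
have H0 : 0 <= sh y ^+ 2 by exact: sqr_ge0.
have dxE : x = (x - X) + X by rewrite subrK.
have sx : sin x ^+ 2 = sin (x - X) ^+ 2 by rewrite {1}dxE sin_Dnpi.
have cx : cos x ^+ 2 = cos (x - X) ^+ 2 by rewrite {1}dxE cos_Dnpi.
have phiX : phi (X, 0) = nsq m.
  have s0 : sin X = 0 by apply/eqP; rewrite -sqrf_eq0 -[X]add0r sin_Dnpi sin0 expr0n.
  have cs0 : csin (toC (X, 0)) = 0.
    by apply/eqP; rewrite -nsq_eq0 nsq_csin /= s0 sh0 expr0n /= addr0.
  rewrite /phi /gfun cs0 mulr0 add0r nsqM nsq_ccos /= sh0 cos2sin2 s0; ring.
have zmin p : A p -> phi (x, y) <= phi p by move=> Ap; apply: pmin; rewrite inE.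
have phiz : nsq (gfun m z) <= nsq m.
  rewrite -phiX; apply: zmin; split => /=; rewrite in_itv /=; apply/andP; split; lra.
have low : nsq z * (sin x ^+ 2 + sh y ^+ 2) / 2 - nsq m * (1 + K) <= nsq m.
  apply: le_trans phiz; apply: le_trans (nsqD_ge _ _).
  rewrite !nsqM nsq_csin nsq_ccos /=.
  have : nsq m * (cos x ^+ 2 + sh y ^+ 2) <= nsq m * (1 + K).
    apply: ler_wpM2l => //; have := cos2Dsin2 x; have := sqr_ge0 (sin x); lra.
  lra.
have inside : ~ (1 / 4 <= sin x ^+ 2 + sh y ^+ 2).
  move=> h; have : nsq z * (1 / 4) <= nsq z * (sin x ^+ 2 + sh y ^+ 2).
    by apply: ler_wpM2l => //; exact: nsq_ge0.
  have : 0 <= nsq (1 - m) * (1 + K) by apply: mulr_ge0 => //; lra.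
  lra.
have dx' : `|x - X| < 1.
  rewrite ltNge; apply/negP => h; apply: inside.
  have := sqr_sin_ge dx; rewrite -sx -[(x - X) ^+ 2]real_normK ?num_real//.
  have -> : `|x - X| = 1 by apply/eqP; rewrite eq_le dx.
  rewrite expr1n; lra.
have dy' : `|y| < 1.
  rewrite ltNge; apply/negP => h; apply: inside.
  have := sqr_le_sh y; rewrite -[y ^+ 2]real_normK ?num_real//.
  have -> : `|y| = 1 by apply/eqP; rewrite eq_le dy.
  have := sqr_ge0 (sin x); rewrite expr1n; lra.
(* The term z cos z dominates (1 - m) sin z, as the real part stays within 1 of n pi. *)
have dg0 : dgfun m z != 0.
  rewrite -nsq_gt0 (_ : dgfun m z = z * ccos z + (1 - m) * csin z); last by rewrite /dgfun; ring.
  apply: lt_le_trans (nsqD_ge _ _); rewrite !nsqM nsq_csin nsq_ccos /=.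
  have c4 : 1 / 4 <= cos x ^+ 2.
    rewrite cx; have := cos_ge_half dx => ch; nra.
  have : nsq z * (1 / 4) <= nsq z * (cos x ^+ 2 + sh y ^+ 2).
    by apply: ler_wpM2l; [exact: nsq_ge0|lra].
  have : nsq (1 - m) * (sin x ^+ 2 + sh y ^+ 2) <= nsq (1 - m) * (1 + K).
    apply: ler_wpM2l => //; have := cos2Dsin2 x; have := sqr_ge0 (cos x); lra.
  have : 0 <= nsq m * (2 + K) by apply: mulr_ge0 => //; lra.
  lra.
exists z; split => //.
pose e := Num.min (1 - `|x - X|) (1 - `|y|).
have e0 : 0 < e by rewrite lt_min !subr_gt0 dx' dy'.
apply: (nsq_gfun_min e0 dg0) => w wr wi.
have -> : z + w = toC (x + Re w, y + Im w) by apply: ceq; rewrite !ReImE.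
apply: (zmin (x + Re w, y + Im w)).
move: wr wi; rewrite !lt_min => /andP[wr _] /andP[_ wi].
split; rewrite /= in_itv /=.
  rewrite -ler_distl (_ : x + Re w - X = (x - X) + Re w); last by ring.
  by apply: le_trans (ler_normD _ _) _; lra.
by rewrite -ler_norml; apply: le_trans (ler_normD _ _) _; lra.
Qed.

End ZeroExistence.

(** * Isolation of the zeros *)

Section ZeroFiniteness.
Local Open Scope complex_scope.
Local Open Scope ring_scope.
Context {R : realType}.
Local Notation C := R[i].
Local Notation Re := (@complex.Re R).
Local Notation Im := (@complex.Im R).
Implicit Types (x y d t r : R) (z w h m : C).

(** Bounds [|sin w|^2 / |w|^2] on the strip [|Im w| <= 1]. *)
Let M : R := 1 + ch 1 ^+ 2.

Let M_gt0 : 0 < M.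
Proof. by rewrite ltr_pwDl// sqr_ge0. Qed.

Lemma sqr_sh_le1 y : `|y| <= 1 -> sh y ^+ 2 <= ch 1 ^+ 2 * y ^+ 2.
Proof.
have pos t : 0 < t -> t <= 1 -> sh t ^+ 2 <= ch 1 ^+ 2 * t ^+ 2.
  move=> t0 t1; have [c /andP[c0 ct]] := mvt0 t0 (@is_derive_sh R).
  rewrite sh0 subr0 => ->; rewrite exprMn ler_wpM2r ?sqr_ge0// !ch2sh2 lerD2l.
  by apply: sqr_sh_le; rewrite gtr0_norm// (le_trans (ltW ct)).
move=> y1; have [->|y0] := eqVneq y 0; first by rewrite sh0 expr0n mulr0.
move: y1; have [y1|y1] := ger0P y; first by apply: pos; rewrite lt_neqAle eq_sym y0.
by rewrite -(sqrrN (sh y)) -(sqrrN y) -shN; apply: pos; rewrite oppr_gt0.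
Qed.

Lemma nsq_csin_le w : `|Im w| <= 1 -> nsq (csin w) <= M * nsq w.
Proof.
move=> /sqr_sh_le1; rewrite nsq_csin /nsq /M; have := sqr_sin_le (Re w).
have := sqr_ge0 (Re w); have := sqr_ge0 (Im w); have := sqr_ge0 (ch 1 : R).
set c := ch 1 ^+ 2; set X := Re w ^+ 2; set Y := Im w ^+ 2 => c0 Y0 X0.
have : 0 <= c * X by exact: mulr_ge0.
lra.
Qed.

(** Along the segment from 0 to [h] the derivative is [- t h^2 sin(t h)], of third order in [h]. The
    factor 2 arises because the real and imaginary parts have different mean value points. *)
Lemma nsq_hcos_sin_le h : `|Im h| <= 1 ->
  nsq (h * ccos h - csin h) <= 2 * M * nsq h ^+ 3.
Proof.
move=> h1.
pose f t : C := t%:C * h * ccos (0 + t%:C * h) - csin (0 + t%:C * h).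
pose df t : C := - (t%:C * h ^+ 2 * csin (0 + t%:C * h)).
have fdf t : cder f (df t) t.
  apply: cder_eq.
    apply: cderB; last exact: cder_csin.
    apply: cderM; last exact: cder_ccos.
    by apply: cderM; [exact: cder_id|exact: cder_cst].
  by rewrite /df; cbv beta; ring.
have f0 : f 0 = 0 by rewrite /f !mul0r addr0 csin0 subr0.
have f1 : f 1 = h * ccos h - csin h by rewrite /f !add0r !mul1r.
have bnd c : 0 < c < 1 -> nsq (df c) <= M * nsq h ^+ 3.
  move=> /andP[c0 c1]; rewrite /df nsqN !nsqM add0r.
  have q0 := nsq_ge0 h.
  have nc : nsq c%:C = c ^+ 2 by rewrite /nsq !ReImE expr0n addr0.
  have : nsq (csin (c%:C * h)) <= M * (c ^+ 2 * nsq h).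
    rewrite -nc -nsqM; apply: nsq_csin_le; rewrite !ReImE mul0r addr0 normrM.
    by rewrite mulr_ile1// gtr0_norm// ltW.
  have c21 : c ^+ 2 <= 1 by rewrite expr_le1// ltW.
  have c20 : 0 <= c ^+ 2 by exact: sqr_ge0.
  have cM : M * (c ^+ 2 * nsq h) <= M * nsq h.
    by rewrite ler_wpM2l ?(ltW M_gt0)// ler_piMl.
  move=> le1; have le2 := le_trans le1 cM.
  rewrite nc expr2 !mulrA.
  apply: (@le_trans _ _ (nsq h * nsq h * (M * nsq h))); last by rewrite le_eqVlt; apply/orP; left; apply/eqP; ring.
  apply: ler_pM => //; rewrite ?nsq_ge0//.
    by rewrite !mulr_ge0// ltW.
  by rewrite -mulrA ler_piMl// mulr_ge0.
have [c1 c1i E1] := @mvt0 R _ _ 1 ltr01 (fun t => proj1 (fdf t)).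
have [c2 c2i E2] := @mvt0 R _ _ 1 ltr01 (fun t => proj2 (fdf t)).
have b1 := bnd _ c1i; have b2 := bnd _ c2i.
rewrite -f1 -mulrA; move: b1 b2; set T := M * _ => b1 b2.
have Rf0 : (Re \o f) 0 = 0 by rewrite /comp f0.
have If0 : (Im \o f) 0 = 0 by rewrite /comp f0.
rewrite Rf0 subr0 mulr1 in E1; rewrite If0 subr0 mulr1 in E2.
rewrite /nsq (_ : Re (f 1) = Re (df c1)) // (_ : Im (f 1) = Im (df c2)) //.
have := sqr_ge0 (Im (df c1)); have := sqr_ge0 (Re (df c2)).
by move: b1 b2; rewrite /nsq; lra.
Qed.

(** In [expand] the coefficient [al] is the derivative at [z0]. If it is nonzero, the linear term
    dominates; otherwise the quadratic term does, whose coefficient [D] is then nonzero. *)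
Lemma gfun0_isolated m z0 : gfun m z0 = 0 ->
  exists2 e, 0 < e & forall h, h != 0 -> `|Re h| < e -> `|Im h| < e ->
    gfun m (z0 + h) != 0.
Proof.
move=> g0; set S := csin z0; set D := ccos z0.
pose al := z0 * D - m * S + S.
have expand h : gfun m (z0 + h) = al * csin h + S * (h * ccos h - csin h) + D * h * csin h.
  transitivity (gfun m z0 * ccos h + (al * csin h + S * (h * ccos h - csin h) + D * h * csin h)).
    by rewrite /gfun /al /S /D csinD ccosD; ring.
  by rewrite g0 mul0r add0r.
have sS := nsq_ge0 S; have sD := nsq_ge0 D.
have M0 := M_gt0.
have MS : 0 <= nsq S * M by rewrite mulr_ge0// ltW.
have MD : 0 <= nsq D * M by rewrite mulr_ge0// ltW.
suff [c [c0 c1 cP]] : exists c, [/\ 0 < c, c <= 1 & forall h, h != 0 -> nsq h < c ->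
    `|Re h| <= 1 -> `|Im h| <= 1 -> gfun m (z0 + h) != 0].
  exists (c / 2); first by lra.
  move=> h hn0 hr hi; apply: cP => //; try lra.
  rewrite /nsq -[Re h ^+ 2]real_normK ?num_real// -[Im h ^+ 2]real_normK ?num_real//.
  have := normr_ge0 (Re h); have := normr_ge0 (Im h); nra.
have csin_ge h : `|Re h| <= 1 -> nsq h / 4 <= nsq (csin h).
  move=> hr; rewrite nsq_csin /nsq; have := sqr_sin_ge hr; have := sqr_le_sh (Im h).
  have := sqr_ge0 (Im h); lra.
have [al0|al0] := eqVneq al 0.
  (* If cos z0 = 0 then sin z0 != 0, so the equation gives z0 = 0, where the cosine is 1. *)
  have D0 : D != 0.
    apply/eqP => D0; have := ccos2csin2 z0; rewrite -/D -/S D0 expr0n add0r => S2.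
    have S0 : S != 0 by apply/eqP => S0; move/eqP: S2; rewrite S0 expr0n eq_sym oner_eq0.
    move: g0; rewrite /gfun -/S -/D D0 mulr0 addr0 => /eqP.
    rewrite mulf_eq0 (negbTE S0) orbF => /eqP z00.
    by move/eqP: D0; rewrite /D z00 ccos0 oner_eq0.
  have D1 : 0 < nsq D by rewrite nsq_gt0.
  (* A zero would give [|D|^2 q^2 / 4 <= 2 |S|^2 M q^3] with [q = nsq h]; the added 1 keeps the
     denominator positive. *)
  pose c := Num.min 1 (nsq D / (8 * (nsq S * M) + 1)).
  exists c; split.
  - by rewrite lt_min ltr01 divr_gt0//; lra.
  - by rewrite ge_min lexx.
  - move=> h hn0; rewrite lt_min => /andP[q1 q2] hr hi; apply/eqP.
    rewrite expand al0 mul0r add0r => /eqP; rewrite addr_eq0 => /eqP /(congr1 nsq).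
    rewrite nsqN !nsqM; have := csin_ge h hr; have := nsq_hcos_sin_le hi.
    have q0 : 0 < nsq h by rewrite nsq_gt0.
    move: q2; rewrite ltr_pdivlMr; last by lra.
    set q := nsq h => q2; set u := nsq (_ - _); set v := nsq (csin h) => Hu Hv E.
    have e1 : nsq D * q * (q / 4) <= nsq S * (2 * M * q ^+ 3).
      apply: (@le_trans _ _ (nsq D * q * v)).
        by apply: ler_wpM2l => //; rewrite mulr_ge0// ltW.
      by rewrite -E; apply: ler_wpM2l.
    have e2 : 0 < q ^+ 2 by rewrite exprn_gt0.
    have : q ^+ 2 * (nsq D - 8 * (nsq S * M) * q) <= 0.
      by rewrite [q ^+ 3]exprS in e1; rewrite expr2 in e1 *; lra.
    rewrite pmulr_rle0// ; nra.
have a0 : 0 < nsq al by rewrite nsq_gt0.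
(* With [q = nsq h <= 1], a zero would give [|al|^2 <= (B - 1) q]. *)
pose B := 4 * (4 * (nsq S * M) + 2 * (nsq D * M)) + 1.
have B0 : 0 < B by rewrite /B; lra.
pose c := Num.min 1 (nsq al / B).
exists c; split.
- by rewrite lt_min ltr01 divr_gt0.
- by rewrite ge_min lexx.
- move=> h hn0; rewrite lt_min => /andP[q1 q2] hr hi; apply/eqP.
  rewrite expand -addrA => /eqP; rewrite addr_eq0 => /eqP /(congr1 nsq).
  rewrite nsqN nsqM => E; have := nsqD_le (S * (h * ccos h - csin h)) (D * h * csin h).
  rewrite -E !nsqM; have := csin_ge h hr; have := nsq_hcos_sin_le hi.
  have := nsq_csin_le hi.
  have q0 : 0 < nsq h by rewrite nsq_gt0.
  move: q2; rewrite ltr_pdivlMr//.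
  set q := nsq h => q2; set u := nsq (_ - _); set v := nsq (csin h) => Hv' Hu Hv Hle.
  have e1 : nsq al * (q / 4) <= nsq al * v by rewrite ler_wpM2l// ltW.
  have e2 : nsq S * u <= nsq S * (2 * M * q ^+ 3) by rewrite ler_wpM2l.
  have e3 : nsq D * q * v <= nsq D * q * (M * q).
    by rewrite ler_wpM2l// mulr_ge0// ltW.
  have q32 : q ^+ 3 <= q ^+ 2 by rewrite [q ^+ 3]exprS ler_piMl ?sqr_ge0// ltW.
  have e4 : nsq S * M * q ^+ 3 <= nsq S * M * q ^+ 2 by rewrite ler_wpM2l.
  have e2' : nsq S * u <= 2 * (nsq S * M * q ^+ 3).
    by apply: le_trans e2 _; rewrite le_eqVlt; apply/orP; left; apply/eqP; ring.
  have e3' : nsq D * q * v <= nsq D * M * q ^+ 2.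
    by apply: le_trans e3 _; rewrite le_eqVlt; apply/orP; left; apply/eqP; ring.
  have : q * (nsq al - (B - 1) * q) <= 0.
    rewrite (_ : q * _ = 4 * (nsq al * (q / 4)) -
      16 * (nsq S * M * q ^+ 2) - 8 * (nsq D * M * q ^+ 2)); last by rewrite /B; field.
    move: e1 e2' e3' e4 Hle; clear.
    set X1 := nsq al * (q / 4); set X2 := nsq al * v; set X3 := nsq S * u.
    set X4 := nsq S * M * q ^+ 3; set X5 := nsq S * M * q ^+ 2.
    set X6 := nsq D * q * v; set X7 := nsq D * M * q ^+ 2; lra.
  rewrite pmulr_rle0// mulrBl mul1r; move: q2 q0; rewrite -/q mulrC; clear.
  set Bq := B * q; lra.
Qed.

End ZeroFiniteness.

(** * Location of the eigenvalues *)

Section SpectralZeros.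
Local Open Scope complex_scope.
Local Open Scope ring_scope.
Context {R : realType}.
Local Notation C := R[i].
Local Notation Re := (@complex.Re R).
Local Notation Im := (@complex.Im R).
Implicit Types (x y d t r l : R) (z w h m mu lam : C).

(** If [K] met [Z] in an infinite set, the sets containing all but finitely many of these points
    would form a proper filter, with a cluster point in [K]; no such point has a neighbourhood with
    finitely many of them. *)
Lemma locally_finite_compact (T : topologicalType) (K Z : set T) : compact K ->
  (forall p, K p -> exists2 V, nbhs p V & finite_set (V `&` Z)) -> finite_set (K `&` Z).
Proof.
move=> cK loc; apply: contrapT => inf.
pose F : set_system T := [set A | finite_set ((K `&` Z) `\` A)].
have FF : ProperFilter F.
  split; first by rewrite /F /= setD0.
  split.
  - by rewrite /F /= setDT; exact: finite_set0.
  - by move=> A B FA FB; rewrite /F /= setDIr finite_setU.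
  - move=> A B AB; apply: sub_finite_set; exact: setDS.
have FK : F K by apply: (sub_finite_set (B := set0)) => // x [[Kx _] /(_ Kx)].
have [p [Kp clp]] := cK F FF FK.
have [V Vp fV] := loc p Kp.
have FV : F (~` V).
  apply: sub_finite_set fV => x [[Kx Zx] nV]; split => //.
  by apply: contrapT => /nV.
by have [x [nVx Vx]] := clp _ _ FV Vp.
Qed.

Lemma gfun_zeros_finite m r :
  finite_set [set p : R * R | gfun m (toC p) = 0 /\ (`|p.1| <= r /\ `|p.2| <= r)].
Proof.
pose Z := [set p : R * R | gfun m (toC p) = 0].
have loc (p : R * R) : exists2 V, nbhs p V & V `&` Z `<=` [set p].
  have [g0|g0] := eqVneq (gfun m (toC p)) 0.
    have [e e0 He] := gfun0_isolated g0.
    exists (ball p e); first exact: nbhsx_ballx.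
    move=> q [[/= b1 b2] Zq]; apply: contrapT => /eqP qp.
    pose h : C := toC q - toC p.
    have hn0 : h != 0.
      apply: contra qp => /eqP h0; apply/eqP.
      have := congr1 Re h0; have := congr1 Im h0; rewrite !ReImE /=.
      case: q {h h0 Zq b1 b2} => q1 q2; case: p {g0 He} => p1' p2' /=.
      by move=> /eqP; rewrite subr_eq0 => /eqP -> /eqP; rewrite subr_eq0 => /eqP ->.
    have qE : toC p + h = toC q by rewrite /h addrC subrK.
    have := He h hn0; rewrite qE (Zq : gfun m (toC q) = 0) eqxx.
    have Rh : `|Re h| < e by rewrite /h !ReImE distrC; exact: b1.
    have Ih : `|Im h| < e by rewrite /h !ReImE distrC; exact: b2.
    by move=> /(_ Rh Ih).
  pose phi (q : R * R) := nsq (gfun m (toC q)).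
  have cphi : continuous phi := @nsq_gfun_continuous R m.
  exists (phi @^-1` [set t | t != 0]).
    apply: (cphi p); apply: open_nbhs_nbhs; split; first exact: open_neq.
    by rewrite /= nsq_eq0.
  by move=> q [/= q0 Zq]; move: q0; rewrite nsq_eq0 Zq eqxx.
pose A : set (R * R) := `[- r, r]%classic `*` `[- r, r]%classic.
have cA : compact A by apply: compact_setX; exact: segment_compact.
have : finite_set (A `&` Z).
  apply: locally_finite_compact => // p _; have [V Vp VZ] := loc p.
  by exists V => //; exact: sub_finite_set VZ (finite_set1 p).
apply: sub_finite_set => p [Zp [p1 p2]]; split => //.
by split; rewrite /= in_itv /= -ler_norml.
Qed.

(** [gfun] is even, so either square root may serve as [z]. *)
Lemma bdry0_gfun l mu lam z : z ^+ 2 = l%:C ^+ 2 * lam ->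
  l%:C * bdry l mu lam 0 = gfun (l%:C * mu) z.
Proof.
pose k := sqrtc lam; have k2 : k ^+ 2 = lam by exact: sqr_sqrtc.
have main : l%:C * bdry l mu lam 0 = gfun (l%:C * mu) (l%:C * k).
  rewrite /bdry /gfun /= subr0.
  transitivity (l%:C * k * (k * sinl lam l) + l%:C * mu * cosl lam l).
    by rewrite -{1}k2; ring.
  by rewrite sqrtc_sinl.
move=> z2; have : z ^+ 2 == (l%:C * k) ^+ 2 by rewrite exprMn k2 z2.
rewrite eqf_sqr => /orP[/eqP ->|/eqP ->]; first exact: main.
by rewrite gfunN; exact: main.
Qed.

Lemma bdry0_eq0 l mu lam z : 0 < l -> z ^+ 2 = l%:C ^+ 2 * lam ->
  bdry l mu lam 0 = 0 <-> gfun (l%:C * mu) z = 0.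
Proof.
move=> l0 /bdry0_gfun <-; split=> [->|/eqP]; first by rewrite mulr0.
by rewrite mulf_eq0 (inj_eq (@complexI R)) gt_eqF// => /eqP.
Qed.

Lemma bdry0_finite l mu (rho : R) : 0 < l ->
  finite_set [set lam | bdry l mu lam 0 = 0 /\ nsq lam <= rho].
Proof.
(* Since [|z|^4 = l^4 |lam|^2], one gets [nsq z <= r]; with [1 <= r] both coordinates of [z] are
   bounded by [r]. *)
move=> l0; pose r := l ^+ 4 * rho + 1.
have lC : l%:C != 0 by rewrite (inj_eq (@complexI R)) gt_eqF.
apply: (@sub_finite_set _ _ ((fun p => toC p ^+ 2 / l%:C ^+ 2) @`
  [set p : R * R | gfun (l%:C * mu) (toC p) = 0 /\ (`|p.1| <= r /\ `|p.2| <= r)])).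
  move=> lam [B0 lr]; pose z := l%:C * sqrtc lam.
  have z2 : z ^+ 2 = l%:C ^+ 2 * lam by rewrite exprMn sqr_sqrtc.
  have zE : toC (Re z, Im z) = z by apply: ceq.
  exists (Re z, Im z); rewrite /= zE; last by rewrite z2 mulrC mulKf// expf_neq0.
  split; first exact/(bdry0_eq0 _ l0 z2).
  have nz : nsq z ^+ 2 <= l ^+ 4 * rho.
    rewrite expr2 -nsqM -expr2 z2 nsqM expr2 nsqM.
    rewrite (_ : nsq l%:C = l ^+ 2); last by rewrite /nsq !ReImE expr0n addr0.
    by rewrite -exprD ler_wpM2l// exprn_ge0// ltW.
  have nz0 := nsq_ge0 z.
  have nzr : nsq z <= r by rewrite /r; nra.
  have r1 : 1 <= r by rewrite /r; have := sqr_ge0 (nsq z); lra.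
  have rr : r <= r ^+ 2 by rewrite expr2 ler_peMl//; lra.
  have r0 : 0 <= r by lra.
  have := sqr_ge0 (Re z); have := sqr_ge0 (Im z); rewrite /nsq in nzr => i0 ii0.
  by split; rewrite -(@ler_pXn2r _ 2)// ?nnegrE// real_normK ?num_real//; lra.
exact/finite_image/gfun_zeros_finite.
Qed.

(** Eliminating the sine between the two vanishing conditions leaves [cosl] times
    [l lam - mu (1 - mu l)]: a double zero can sit at one value of lam only. *)
Lemma bdry1_neq0 l mu lam : 0 < l -> bdry l mu lam 0 = 0 ->
  l%:C * lam != mu * (1 - mu * l%:C) -> bdry l mu lam 1 != 0.
Proof.
move=> l0 B0; apply: contra => /eqP B1; have [lam0 _] := bdry2_neq0 l0 B0 B1.
have c0 := bdry0_cosl_neq0 B0; move: B0 B1 c0; rewrite /bdry /= !subr0.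
set c := cosl lam l; set s := sinl lam l => B0 B1 c0.
have two0 : (2 : C) != 0 by rewrite pnatr_eq0.
have B1' : s + l%:C * c - mu * l%:C * s = 0.
  transitivity (2 * ((s + l%:C * c) / 2 + mu * (- (l%:C * s) / 2))); first by field.
  by rewrite B1 mulr0.
rewrite -subr_eq0; apply/eqP/(mulfI c0); rewrite mulr0.
transitivity (lam * (s + l%:C * c - mu * l%:C * s) - (1 - mu * l%:C) * (lam * s + mu * c)).
  by ring.
by rewrite B0 B1' !mulr0 subr0.
Qed.

Lemma near_npi_inj (n n' : nat) z : near_npi n z -> near_npi n' z -> n = n'.
Proof.
have p2 := @pi_ge2 R.
have lt (k k' : nat) : near_npi k z -> near_npi k' z -> ~ (k < k')%N.
  move=> [h _] [h' _] kk'.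
  have : (k%:R + 1) * pi <= k'%:R * pi :> R.
    by rewrite ler_wpM2r ?pi_ge0// natr1 ler_nat.
  move: h h'; rewrite !ler_norml => /andP[_ h] /andP[h' _]; lra.
move=> zn zn'; case: (ltngtP n n') => // /lt; [move/(_ zn zn')|move/(_ zn' zn)]; by [].
Qed.

(** [f n] is [(z n / l)^2] with [z n] the zero near n pi. The windows [n - 1], [n + 1] leave ample
    room for the distance 1/4 and for the imaginary part. *)
Lemma bdry0_asymptotics l mu : 0 < l ->
  exists (N : nat) (rho : R) (f : nat -> C),
  [/\ (0 < N)%N,
    forall n, (N <= n)%N -> bdry l mu (f n) 0 = 0 /\
      ((n%:R - 1) * pi / l) ^+ 2 <= Re (f n) <= ((n%:R + 1) * pi / l) ^+ 2,
    forall n n', (N <= n)%N -> (N <= n')%N -> f n = f n' -> n = n' &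
    forall lam, bdry l mu lam 0 = 0 -> rho < nsq lam ->
      exists2 n, (N <= n)%N & lam = f n].
Proof.
move=> l0; have p2 := @pi_ge2 R; pose m := l%:C * mu.
have lC : l%:C != 0 by rewrite (inj_eq (@complexI R)) gt_eqF.
have l2C : l%:C ^+ 2 != 0 by rewrite expf_neq0.
have m0 := nsq_ge0 m; have m1 := nsq_ge0 (1 - m).
pose K : R := sh 1 ^+ 2; have K0 : 0 <= K by exact: sqr_ge0.
have mK : 0 <= nsq m * (2 + K) by rewrite mulr_ge0//; lra.
have m1K : 0 <= nsq (1 - m) * (1 + K) by rewrite mulr_ge0//; lra.
(* The sum of the threshold for existence and the one for localisation and uniqueness. *)
pose bnd := 1 + 8 * (nsq m * (2 + K) + nsq (1 - m) * (1 + K)) + (64 * nsq m + 1).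
have bnd0 : 0 <= bnd by rewrite /bnd; lra.
pose N := (Num.truncn bnd).+1.
have large (n : nat) : (N <= n)%N -> 1 <= n%:R :> R /\ bnd < (n%:R * pi - 1) ^+ 2.
  move=> Nn; have n1 : 1 <= n%:R :> R by rewrite ler1n (leq_trans _ Nn).
  split => //; have bN : bnd < n%:R.
    by rewrite (lt_le_trans (truncnS_gt bnd))// ler_nat.
  have n2 : n%:R * 2 <= n%:R * pi :> R by rewrite ler_wpM2l ?ler0n.
  have h : n%:R <= n%:R * pi - 1 :> R by move: (n%:R * pi) n2 => q n2; lra.
  rewrite (lt_le_trans bN)// (le_trans h)// expr2 ler_peMl//; lra.
have zex (n : nat) : exists z, (N <= n)%N ->
    [/\ gfun m z = 0, 64 * nsq m + 1 <= nsq z & near_npi n z].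
  have [Nn|nN] := boolP (N <= n)%N; last by exists 0.
  have [n1 bn] := large n Nn.
  have [||z [gz xz yz]] := @gfun_zero_exists R m n.
  - by rewrite -/K; apply: le_lt_trans bn; rewrite /bnd; lra.
  - nra.
  exists z => _.
  have mz : 64 * nsq m + 1 <= nsq z.
    have : (n%:R * pi - 1) ^+ 2 <= Re z ^+ 2.
      move: xz; rewrite ltr_norml => /andP[x1 x2].
      have ? : 1 <= n%:R * pi :> R by nra.
      by rewrite ler_pXn2r ?nnegrE//; lra.
    have := sqr_ge0 (Im z); rewrite {2}/nsq; move: bn; rewrite /bnd; lra.
  split => //; apply: gfun0_near gz mz _; lra.
have /choice[z zP] := zex; pose f n := z n ^+ 2 / l%:C ^+ 2.
have fE n : z n ^+ 2 = l%:C ^+ 2 * f n by rewrite /f mulrC divfK.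
have Rez (n : nat) : (N <= n)%N -> 0 < Re (z n).
  move=> Nn; have [n1 _] := large n Nn; have [_ _ [+ _]] := zP n Nn.
  rewrite ler_norml => /andP[h _]; nra.
(* Beyond [T] a zero near n pi has [n >= N] and passes the uniqueness threshold; [T^2 / l^4]
   restates this in terms of [nsq lam]. *)
pose T := (N%:R * pi + 1) ^+ 2 + 1 + (64 * nsq m + 1).
exists N, (T ^+ 2 / l ^+ 4), f; split => //.
- move=> n Nn; have [gz mz [xz yz]] := zP n Nn; split.
    exact/(bdry0_eq0 _ l0 (fE n)).
  have [n1 _] := large n Nn.
  have Ref : Re (f n) = (Re (z n) ^+ 2 - Im (z n) ^+ 2) / l ^+ 2.
    rewrite /f (_ : (l%:C ^+ 2)^-1 = (l ^- 2)%:C); last by rewrite fmorphV rmorphXn.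
    by rewrite !expr2 !ReImE mulr0 subr0.
  rewrite Ref !expr_div_n; set X := Re (z n) in xz *; set Y := Im (z n) in yz *.
  have Y2 : Y ^+ 2 <= 1 / 16.
    by rewrite -real_normK ?num_real//; have := normr_ge0 Y; nra.
  have Y0 := sqr_ge0 Y.
  move: xz; rewrite ler_norml => /andP[x1 x2].
  rewrite !ler_pM2r ?invr_gt0 ?exprn_gt0//; apply/andP; split.
    have a1 : (n%:R * pi - 1 / 4) ^+ 2 <= X ^+ 2.
      by rewrite ler_pXn2r ?nnegrE//; nra.
    apply: (@le_trans _ _ ((n%:R * pi - 1 / 4) ^+ 2 - 1 / 16)); last lra.
    have : 0 <= (n%:R - 1) * pi :> R by rewrite mulr_ge0 ?pi_ge0// subr_ge0.
    rewrite mulrBl mul1r; set q := n%:R * pi => q1; nra.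
  have a1 : X ^+ 2 <= (n%:R * pi + 1 / 4) ^+ 2.
    by rewrite ler_pXn2r ?nnegrE//; nra.
  apply: (@le_trans _ _ ((n%:R * pi + 1 / 4) ^+ 2)); first lra.
  have : 0 <= n%:R * pi :> R by rewrite mulr_ge0 ?pi_ge0.
  by rewrite ler_pXn2r ?nnegrE//; nra.
- move=> n n' Nn Nn' ff.
  have [gz mz nz] := zP n Nn; have [gz' mz' nz'] := zP n' Nn'.
  have : z n ^+ 2 == z n' ^+ 2 by rewrite !fE ff.
  rewrite eqf_sqr => /orP[/eqP zz|/eqP zz].
    by rewrite zz in nz; exact: near_npi_inj nz nz'.
  exfalso; have := Rez n Nn; rewrite zz cReN; have := Rez n' Nn'; lra.
- move=> lam B0 rl.
  (* Of the two roots, the one in the right half plane is taken, as the zeros [z n] lie there. *)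
  have [w [w2 w0]] : exists w, w ^+ 2 = l%:C ^+ 2 * lam /\ 0 <= Re w.
    pose w := l%:C * sqrtc lam.
    have w2 : w ^+ 2 = l%:C ^+ 2 * lam by rewrite exprMn sqr_sqrtc.
    have [w0|w0] := leP 0 (Re w); first by exists w.
    by exists (- w); rewrite sqrrN cReN oppr_ge0 ltW.
  have gw : gfun m w = 0 by apply/(bdry0_eq0 _ l0 w2).
  have T0 : 0 <= T by rewrite /T; have := sqr_ge0 (N%:R * pi + 1 : R); lra.
  have Tw : T < nsq w.
    rewrite -(@ltr_pXn2r _ 2)// ?nnegrE ?nsq_ge0//.
    rewrite [X in _ < X]expr2 -nsqM -expr2 w2 nsqM expr2 nsqM.
    rewrite (_ : nsq l%:C = l ^+ 2); last by rewrite /nsq !ReImE expr0n addr0.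
    by rewrite -exprD [X in _ < X]mulrC -ltr_pdivrMr ?exprn_gt0.
  have mw : 64 * nsq m + 1 <= nsq w.
    move: Tw; rewrite /T; have := sqr_ge0 (N%:R * pi + 1 : R); lra.
  have [n nw] := gfun0_near_npi gw mw w0.
  have Nn : (N <= n)%N.
    rewrite leqNgt; apply/negP => nN.
    have nNR : n%:R * pi <= N%:R * pi :> R by rewrite ler_wpM2r ?pi_ge0// ler_nat ltnW.
    have nR0 : 0 <= n%:R * pi :> R by rewrite mulr_ge0 ?pi_ge0.
    case: nw; rewrite !ler_norml => /andP[_ x2] /andP[y1 y2].
    have : Re w ^+ 2 <= (N%:R * pi + 1) ^+ 2 by rewrite ler_pXn2r ?nnegrE//; lra.
    have : Im w ^+ 2 <= 1 by nra.
    by move: Tw; rewrite /T [nsq w]/nsq; lra.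
  exists n => //; have [gz mz nz] := zP n Nn.
  have E : w = z n := gfun0_unique gw gz mw mz nw nz.
  by apply: (mulfI l2C); rewrite -w2 -fE E.
Qed.

End SpectralZeros.

(** * Counting *)

Section Counting.
Local Open Scope complex_scope.
Local Open Scope ring_scope.
Context {R : realType}.
Local Notation C := R[i].
Local Notation Re := (@complex.Re R).
Local Notation Im := (@complex.Im R).

Lemma bmult_le2 (l : R) (mu lam : C) : (bmult l mu lam <= 2)%N.
Proof. by rewrite /bmult; case: ifP => // _; case: ifP. Qed.

Lemma sum_nat_of_bool (T : Type) (s : seq T) (P : pred T) :
  \sum_(x <- s) (P x)%:R = (count P s)%:R :> R.
Proof.
by elim: s => [|x s IH]; rewrite ?big_nil// big_cons IH /= natrD.
Qed.

Lemma bmult_simple (l : R) (mu lam : C) : 0 < l ->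
  nsq (mu * (1 - mu * l%:C) / l%:C) < nsq lam ->
  bmult l mu lam = (bdry l mu lam 0 == 0).
Proof.
move=> l0 big; rewrite /bmult; case: eqP => //= B0.
have lC : l%:C != 0 by rewrite (inj_eq (@complexI R)) gt_eqF.
rewrite (bdry1_neq0 l0 B0)//; apply/eqP => E; move: big.
by rewrite -E [l%:C * _]mulrC mulfK// ltxx.
Qed.

Lemma sqr_pi_lt (l r x : R) : 0 < l -> 0 < r -> 0 <= x ->
  ((x * pi / l) ^+ 2 < r) = (x < l * Num.sqrt r / pi).
Proof.
move=> l0 r0 x0; have p0 := @pi_gt0 R.
have sr0 : 0 < Num.sqrt r by rewrite sqrtr_gt0.
rewrite -{1}(sqr_sqrtr (ltW r0)) ltr_pXn2r ?nnegrE ?(ltW sr0)//; last first.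
  by rewrite divr_ge0 ?mulr_ge0// ltW.
by rewrite ltr_pdivrMr// ltr_pdivlMr// [l * _]mulrC.
Qed.

Definition large_root (l : R) (mu : C) (rho r : R) : pred C :=
  fun lam => [&& bdry l mu lam 0 == 0, rho < nsq lam & Re lam < r].

(** The list [s] may contain more than the zeros for [mu], so one list of eigenvalues serves both
    families; [rho] is left free so that they can share a cutoff. *)
Lemma bdry0_count (l : R) (mu : C) : 0 < l ->
  exists rho0 : R, forall rho, rho0 <= rho -> 0 <= rho ->
  exists N : nat, forall r (s : seq C), 0 < r -> uniq s ->
    (forall lam, bdry l mu lam 0 = 0 -> Re lam < r -> lam \in s) ->
    l * Num.sqrt r / pi - 2 - N%:R <= (count (large_root l mu rho r) s)%:R
      <= l * Num.sqrt r / pi + 2.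
Proof.
move=> l0; have [N [rho0 [f [N0 fP finj fsurj]]]] := bdry0_asymptotics mu l0.
have p2 := @pi_ge2 R; have p0 := @pi_gt0 R.
exists rho0 => rho rho01 rho_ge0.
(* For [n >= N'], [(n - 1) pi / l] is at least [rho + 1], hence so is [Re (f n)], and [f n] passes
   the cutoff. *)
pose N' := ((Num.truncn (l * (rho + 1))).+2 + N)%N.
exists N' => r s r0 us sP.
set c := count _ s; set t := l * Num.sqrt r / pi.
have t0 : 0 < t by rewrite divr_gt0 ?mulr_gt0 ?sqrtr_gt0.
apply/andP; split.
  (* [n < M'] gives [n + 1 < t], so the upper end of the window of [f n] lies below [r]; for [t < 1]
     the range is empty. *)
  pose M' := (Num.truncn t).-1.
  have M't : M'%:R + 1 <= t \/ M' = 0%N.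
    rewrite /M'; case E : (Num.truncn t) => [|k] /=; first by right.
    by left; rewrite natr1 -E truncn_le ?ltW.
  have tM' : t <= M'%:R + 2.
    rewrite /M'; have := truncnS_gt t; case: (Num.truncn t) => [|k] /=; lra.
  have sub : (M' - N' <= c)%N.
    rewrite -(size_iota N' (M' - N')) -(size_map f) /c -size_filter.
    apply: uniq_leq_size.
      rewrite map_inj_in_uniq ?iota_uniq// => n n'; rewrite !mem_iota.
      move=> /andP[n1 _] /andP[n2 _].
      by apply: finj; [exact: leq_trans (leq_addl _ _) n1|exact: leq_trans (leq_addl _ _) n2].
    move=> _ /mapP[n + ->]; rewrite mem_iota => /andP[N'n nM'].
    have nM : (n < M')%N.
      move: nM'; have [le|/ltnW] := leqP N' M'; first by rewrite subnKC.
      by rewrite -subn_eq0 => /eqP ->; rewrite addn0 ltnNge N'n.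
    have Nn : (N <= n)%N by rewrite (leq_trans _ N'n)// leq_addl.
    have [B0 /andP[f1 f2]] := fP n Nn.
    have nt : n%:R + 1 < t.
      case: M't => [M't|M'0]; last by rewrite M'0 in nM.
      by apply: lt_le_trans M't; rewrite ltrD2r ltr_nat.
    have n0 : 0 <= n%:R :> R by exact: ler0n.
    have fr : Re (f n) < r.
      by apply: le_lt_trans f2 _; rewrite sqr_pi_lt// addr_ge0.
    rewrite mem_filter sP// andbT /large_root B0 eqxx fr andbT /=.
    have n1 : l * (rho + 1) <= n%:R - 1 :> R.
      have : (Num.truncn (l * (rho + 1))).+1%:R + 1 <= n%:R :> R.
        by rewrite natr1 ler_nat (leq_trans _ N'n)// /N' leq_addr.
      have := truncnS_gt (l * (rho + 1)); lra.
    have a1 : rho + 1 <= (n%:R - 1) * pi / l.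
      rewrite ler_pdivlMr// mulrC; apply: (le_trans n1).
      have : 0 <= n%:R - 1 :> R by apply: (le_trans _ n1); rewrite mulr_ge0 ?ltW//; lra.
      by move=> ?; rewrite ler_peMr//; lra.
    have a2 : rho + 1 <= ((n%:R - 1) * pi / l) ^+ 2.
      apply: (le_trans a1); rewrite expr2 ler_peMl//; lra.
    have a3 : rho + 1 <= Re (f n) by exact: le_trans f1.
    rewrite /nsq; have := sqr_ge0 (Im (f n)).
    have : Re (f n) <= Re (f n) ^+ 2 by rewrite expr2 ler_peMl//; lra.
    lra.
  have : M'%:R <= c%:R + N'%:R :> R.
    by rewrite -natrD ler_nat addnC -leq_subLR.
  lra.
(* The lower end of the window now matters: [Re (f n) < r] gives [n - 1 < t], hence [n < M]. *)
pose M := (Num.truncn (t + 1)).+1.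
have Mt : M%:R <= t + 2.
  rewrite /M -natr1; have : (Num.truncn (t + 1))%:R <= t + 1 by rewrite truncn_le// addr_ge0// ltW.
  lra.
apply: le_trans Mt; rewrite ler_nat -(size_iota 0 M) -(size_map f) /c -size_filter.
apply: uniq_leq_size; first exact: filter_uniq.
move=> lam; rewrite mem_filter => /andP[/and3P[/eqP B0 rl lr] _].
have [n Nn lamE] := fsurj lam B0 (le_lt_trans rho01 rl).
rewrite lamE; apply: map_f; rewrite mem_iota add0n /= /M.
have [_ /andP[f1 _]] := fP n Nn.
rewrite -(ltr_nat R); apply: lt_trans (truncnS_gt _); rewrite -ltrBlDr.
have n1 : 1 <= n%:R :> R by rewrite ler1n (leq_trans N0).
have : ((n%:R - 1) * pi / l) ^+ 2 < r by apply: le_lt_trans f1 _; rewrite -lamE.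
by rewrite sqr_pi_lt// subr_ge0.
Qed.

Lemma bdry0_lt_finite (l : R) (mu : C) (r : R) : 0 < l -> 0 < r ->
  finite_set [set lam | bdry l mu lam 0 = 0 /\ Re lam < r].
Proof.
move=> l0 r0; have [N [rho0 [f [N0 fP finj fsurj]]]] := bdry0_asymptotics mu l0.
pose M := (Num.truncn (l * Num.sqrt r / pi + 1)).+1.
apply: (@sub_finite_set _ _ ([set lam | bdry l mu lam 0 = 0 /\ nsq lam <= rho0] `|` f @` `I_M)).
  move=> lam [B0 lr]; have [|rl] := leP (nsq lam) rho0; first by left.
  right; have [n Nn lamE] := fsurj lam B0 rl; exists n => //=.
  have [_ /andP[f1 _]] := fP n Nn.
  rewrite -(ltr_nat R); apply: lt_trans (truncnS_gt _); rewrite -ltrBlDr.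
  have n1 : 1 <= n%:R :> R by rewrite ler1n (leq_trans N0).
  by rewrite -sqr_pi_lt ?subr_ge0// (le_lt_trans f1)// -lamE.
rewrite finite_setU; split; first exact: bdry0_finite.
exact/finite_image/finite_II.
Qed.

End Counting.

(** * Algebraic multiplicities in terms of the two families *)

Section EigenvalueCount.
Local Open Scope complex_scope.
Local Open Scope ring_scope.
Context {R : realType}.
Local Notation C := R[i].
Local Notation Re := (@complex.Re R).

(** [cosl lam l] is nonzero, so a zero [lam] determines [mu]; families with different parameters are
    disjoint. *)
Lemma bdry0_same_root (l : R) (mu mu' lam : C) :
  bdry l mu lam 0 = 0 -> bdry l mu' lam 0 = 0 -> mu = mu'.
Proof.
move=> B B'; apply: (mulIf (bdry0_cosl_neq0 B)); move: B B'.
rewrite /bdry /= !subr0 => B B'.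
by apply: (addrI (lam * sinl lam l)); rewrite B B'.
Qed.

Lemma alg_mult_bounds (l a b : R) : 0 < l ->
  exists (mu1 mu2 : C) (rho0 : R), [/\ 0 <= rho0,
    forall lam, T_eigenvalue l a b lam <->
      bdry l mu1 lam 0 = 0 \/ bdry l mu2 lam 0 = 0 &
    forall lam, T_eigenvalue l a b lam ->
      exists al : R, [/\ alg_mult l a b lam = al%:E, 0 <= al <= 4 &
        rho0 < nsq lam ->
        al = (bdry l mu1 lam 0 == 0)%:R + (bdry l mu2 lam 0 == 0)%:R]].
Proof.
move=> l0; have [mu1 [mu2 [p1 [p2 [kap [tri sum12 prod12]]]]]] := triangularizable a b.
have char1 : mu1 ^+ 2 = 'i%C * a%:C * mu1 + b%:C ^+ 2.
  by rewrite -sum12 -[b%:C ^+ 2]opprK -prod12; ring.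
have char2 : mu2 ^+ 2 = 'i%C * a%:C * mu2 + b%:C ^+ 2.
  by rewrite -sum12 -[b%:C ^+ 2]opprK -prod12; ring.
pose th mu := nsq (mu * (1 - mu * l%:C) / l%:C).
exists mu1, mu2, (Num.max (th mu1) (th mu2)).
have eigP lam : T_eigenvalue l a b lam <-> bdry l mu1 lam 0 = 0 \/ bdry l mu2 lam 0 = 0.
  split=> [/(T_eigenvalue_bmult l0 tri)|[]]; last 2 first.
  - exact: bdry0_T_eigenvalue.
  - exact: bdry0_T_eigenvalue.
  rewrite addn_gt0 /bmult => /orP[|].
    by case: eqP => //=; left.
  by case: eqP => //=; right.
split => //; first by rewrite le_max nsq_ge0.
move=> lam elam; have fin := alg_mult_fin lam l0 tri.
have ub := alg_mult_le lam l0 tri; have lb := eigenvalue_alg_mult_ge1 elam.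
exists (fine (alg_mult l a b lam)); rewrite fineK//; split => //.
  rewrite -!lee_fin fineK// alg_mult_ge0 /=; apply: le_trans ub _.
  by rewrite lee_fin ler_nat (leq_add (bmult_le2 _ _ _) (bmult_le2 _ _ _)).
rewrite gt_max => /andP[/(bmult_simple l0) m1 /(bmult_simple l0) m2].
rewrite m1 m2 in ub.
apply/eqP; rewrite eq_le -!lee_fin fineK// -natrD ub /=.
case: eqP => B1; case: eqP => B2 //=.
  (* A common zero forces a double eigenvalue of iM; in the other cases multiplicity at least 1
     suffices. *)
  have mu12 := bdry0_same_root B1 B2; rewrite -mu12 in sum12 prod12.
  apply: (alg_mult_ge2 l0 _ _ B1).
  - by rewrite -sum12; ring.
  - by rewrite expr2.
  - by move: m1; rewrite /bmult B1 eqxx /=; case: eqP.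
by case: (eigP lam) => /(_ elam) [].
Qed.

End EigenvalueCount.

Unset Implicit Arguments.

Theorem theorem1p5 (R : realType) (l a b : R) (hl : 0 < l) :
  (forall r : R, 0 < r -> eig_count l a b r \is a fin_num) /\
  (exists K : R, \forall r \near +oo_R,
    `|fine (eig_count l a b r) - 2 * l * Num.sqrt r / pi| <= K).
Proof.
have [mu1 [mu2 [rho0 [rho00 eigP alP]]]] := alg_mult_bounds a b hl.
have [rho1 cnt1] := bdry0_count mu1 hl; have [rho2 cnt2] := bdry0_count mu2 hl.
(* Beyond this cutoff multiplicities are exact and both counts are valid. *)
pose rho := Num.max rho0 (Num.max rho1 rho2).
have rho_ge0 : 0 <= rho by rewrite /rho le_max rho00.
have [|//|N1 {}cnt1] := cnt1 rho; first by rewrite /rho !le_max lexx orbT.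
have [|//|N2 {}cnt2] := cnt2 rho; first by rewrite /rho !le_max lexx !orbT.
pose X r := [set lam : R[i] | T_eigenvalue l a b lam /\ complex.Re lam < r].
pose Small := [set lam | bdry l mu1 lam 0 = 0 /\ nsq lam <= rho] `|`
              [set lam | bdry l mu2 lam 0 = 0 /\ nsq lam <= rho].
have finSmall : finite_set Small.
  by rewrite finite_setU; split; exact: bdry0_finite.
pose Q := size (finmap.enum_fset (fset_set Small)).
pose t r := l * Num.sqrt r / pi.
(* Each family deviates from [t r] by at most 2, plus its [N1] or [N2] on the lower side; at most
   [Q] small eigenvalues add at most 4 each. *)
suff main r : 0 < r -> exists S : R, eig_count l a b r = S%:E /\
    2 * t r - (4 + N1%:R + N2%:R) <= S <= 2 * t r + 4 + 4 * Q%:R.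
  split=> [r /main[S [-> _]]//|].
  exists (4 + N1%:R + N2%:R + 4 * Q%:R); near=> r.
  have r0 : 0 < r by near: r; exact: nbhs_pinfty_gt.
  have [S [-> /andP[S1 S2]]] := main r r0; rewrite /=.
  have -> : 2 * l * Num.sqrt r / pi = 2 * t r by rewrite /t !mulrA.
  have n1 : 0 <= N1%:R :> R by exact: ler0n.
  have n2 : 0 <= N2%:R :> R by exact: ler0n.
  have q0 : 0 <= Q%:R :> R by exact: ler0n.
  by rewrite ler_norml; apply/andP; split; lra.
move=> r0.
have finX : finite_set (X r).
  apply: (@sub_finite_set _ _ ([set lam | bdry l mu1 lam 0 = 0 /\ complex.Re lam < r] `|`
    [set lam | bdry l mu2 lam 0 = 0 /\ complex.Re lam < r])).
    by move=> lam [/eigP[] B0 lr]; [left|right].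
  by rewrite finite_setU; split; exact: bdry0_lt_finite.
pose s := finmap.enum_fset (fset_set (X r)).
have us : uniq s by exact: finmap.fset_uniq.
have sX lam : (lam \in s) = (lam \in X r) by rewrite /s -in_fset_set.
have sub1 lam : bdry l mu1 lam 0 = 0 -> complex.Re lam < r -> lam \in s.
  by move=> B0 lr; rewrite sX inE; split => //; apply/eigP; left.
have sub2 lam : bdry l mu2 lam 0 = 0 -> complex.Re lam < r -> lam \in s.
  by move=> B0 lr; rewrite sX inE; split => //; apply/eigP; right.
have /andP[l1 u1] := cnt1 r s r0 us sub1; have /andP[l2 u2] := cnt2 r s r0 us sub2.
pose al lam := fine (alg_mult l a b lam).
have alE lam : lam \in s -> alg_mult l a b lam = (al lam)%:E.
  by rewrite sX inE => -[/alP[z [E _ _]] _]; rewrite /al E.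
exists (\sum_(lam <- s) al lam); split.
  rewrite /eig_count esum_fset//; last first.
    by move=> lam _; exact: alg_mult_ge0.
  rewrite fsbig_finite//= -sumEFin; apply: eq_big_seq => lam lams.
  exact: alE.
pose P1 := large_root l mu1 rho r; pose P2 := large_root l mu2 rho r.
pose P3 lam := lam \in finmap.enum_fset (fset_set Small).
have P3E lam : P3 lam = (lam \in Small) by rewrite /P3 -in_fset_set.
have c3 : (count P3 s <= Q)%N.
  rewrite -size_filter; apply: uniq_leq_size; first exact: filter_uniq.
  by move=> lam; rewrite mem_filter => /andP[].
(* Below the cutoff [P1] and [P2] are false and the term with [P3] absorbs the multiplicity; above
   it the lower bound is attained. *)
have al_bounds lam : lam \in s ->
    (P1 lam)%:R + (P2 lam)%:R <= al lam <= (P1 lam)%:R + (P2 lam)%:R + 4 * (P3 lam)%:R.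
  move=> lams; have := lams; rewrite sX inE => -[elam lr].
  have [z [zE /andP[z0 z4] zbig]] := alP lam elam; rewrite /al zE /=.
  rewrite /P1 /P2 /large_root lr !andbT.
  have [small|big] := leP (nsq lam) rho.
    rewrite !andbF /= addr0 add0r z0 (_ : P3 lam) ?mulr1//.
    rewrite P3E inE.
    by case/eigP: elam => B0; [left|right].
  rewrite !andbT zbig ?lexx /=; last by rewrite (le_lt_trans _ big)// /rho le_max lexx.
  by rewrite lerDl mulr_ge0.
have S1 : \sum_(lam <- s) ((P1 lam)%:R + (P2 lam)%:R) <= \sum_(lam <- s) al lam.
  by rewrite big_seq [X in _ <= X]big_seq; apply: ler_sum => lam /al_bounds/andP[].
have S2 : \sum_(lam <- s) al lam <=
    \sum_(lam <- s) ((P1 lam)%:R + (P2 lam)%:R + 4 * (P3 lam)%:R).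
  by rewrite big_seq [X in _ <= X]big_seq; apply: ler_sum => lam /al_bounds/andP[].
rewrite big_split /= in S1; rewrite !big_split /= -mulr_sumr in S2.
rewrite !sum_nat_of_bool in S1 S2.
have c3' : (count P3 s)%:R <= Q%:R :> R by rewrite ler_nat.
move: l1 u1 l2 u2; rewrite -/(t r) => l1 u1 l2 u2.
by apply/andP; split; lra.
Unshelve. all: by end_near. Qed.
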